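(* Let $G=\mathrm{SL}(2,\mathbf C)$. The kernel of the conjugation-invariant differential operator $$D=-\operatorname{tr}(g)^3\,\Delta+\operatorname{tr}(g)\,\Psi^2+(\operatorname{tr}(g)^2+4)\,\Psi$$ on $G$, intersected with $\mathbf C[\mathrm{SL}(2,\mathbf C)]^{\mathrm{Ad}\,N}$, consists of the linear hull of all the functions $(g_{12})^n$, $n\in\mathbf N$ (including $n=0$). Hence the conjugation action of $\mathrm{SL}(2,\mathbf C)$ on itself is harmonic.
   Context: $g_{12}$ denotes the $(1,2)$ matrix coefficient function on $G=\mathrm{SL}(2,\mathbf C)$, $\operatorname{tr}(g)$ acts as multiplication by the trace function. $N$ is the group of lower triangular unipotent matrices in $G$, and $\mathbf C[G]^{\mathrm{Ad}\,N}$ is the space of regular functions on $G$ invariant under conjugation by $N$. $\Psi$ is the conjugation-invariant vector field on $G$ defined by the map $g\mapsto g-g^{-1}\in\mathfrak{sl}(2,\mathbf C)$, i.e. $\Psi f(g)=\frac{d}{dt}f(g+tg(g-g^{-1}))|_{t=0}$ (with $f$ extended to a neighborhood of $G$ in the $2\times2$ matrices), and $\Psi^2=\Psi\circ\Psi$. $\Delta$ is the Casimir operator (generator of the center of $U(\mathfrak g)$, acting as a bi-invariant differential operator on $G$), normalized so that it acts as the scalar $d(d+2)$ on the summand $S^dV\otimes(S^dV)^*$ (span of the matrix coefficients of $S^dV$, $V=\mathbf C^2$) in the decomposition $\mathbf C[G]\cong\bigoplus_{d\ge0}S^dV\otimes(S^dV)^*$ under left and right translations. An action of a reductive algebraic group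 $L$ on an irreducible affine variety $M$ is called cofree if there is an $L$-invariant subspace $H\subset\mathbf C[M]$ such that the multiplication map $H\otimes\mathbf C[M]^L\to\mathbf C[M]$, $h\otimes f\mapsto hf$, is an isomorphism of vector spaces. A cofree action is called harmonic if there exist $L$-invariant (algebraic) differential operators $D_1,\dots,D_n$ on $M$ such that the linear space $H=\bigcap_{i=1}^n\ker D_i\subset\mathbf C[M]$ realizes this isomorphism. *)

(* Defs.v *)
From HB Require Import structures.
From mathcomp Require Import all_boot all_order all_algebra.
From mathcomp Require Import mpoly complex boolp classical_sets functions reals.
From mathcomp Require Import ring.

Set Implicit Arguments.
Unset Strict Implicit.
Unset Printing Implicit Defensive.

Import GRing.Theory Num.Theory.
Local Open Scope classical_set_scope.
Local Open Scope ring_scope.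

(* Cofree and harmonic actions, in terms of the coordinate algebra A = K[M] of
   an affine variety M and the induced action of the group L on A. *)
Section Harmonic.
Variables (K : fieldType) (A : comAlgType K) (L : groupType).
Variable act : L -> A -> A.

Definition subspace (H : set A) : Prop :=
  H 0 /\ forall (a : K) (u v : A), H u -> H v -> H (a *: u + v).

Definition lin_hull (S : set A) : set A :=
  [set a | exists2 s : seq (K * A),
    {in s, forall x, S x.2} & a = \sum_(x <- s) x.1 *: x.2].

Definition stable (H : set A) : Prop := forall l a, H a -> H (act l a).

Definition invariants (S : set L) : set A :=
  [set a | forall l, S l -> act l a = a].

(* A list of pairs in H x B stands for the sum of the pure tensors h (x) b.
   By the universal property of the tensor product, two such sums are equal
   in H (x) B iff no bilinear map on H x B separates them. *)
Definition bilinear_on (H B : set A) (W : lmodType K) (phi : A -> A -> W) :=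
  (forall (a : K) u v b, H u -> H v -> B b ->
     phi (a *: u + v) b = a *: phi u b + phi v b) /\
  (forall (a : K) h u v, H h -> B u -> B v ->
     phi h (a *: u + v) = a *: phi h u + phi h v).

Definition tensors (H B : set A) (s : seq (A * A)) : Prop :=
  {in s, forall x, H x.1 /\ B x.2}.

Definition tensor_eq (H B : set A) (s t : seq (A * A)) : Prop :=
  forall (W : lmodType K) (phi : A -> A -> W), bilinear_on H B phi ->
    \sum_(x <- s) phi x.1 x.2 = \sum_(x <- t) phi x.1 x.2.

Definition mul_tensor (s : seq (A * A)) : A := \sum_(x <- s) x.1 * x.2.

Definition mul_tensor_iso (H B : set A) : Prop :=
  (forall s t, tensors H B s -> tensors H B t ->
     mul_tensor s = mul_tensor t -> tensor_eq H B s t) /\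
  (forall a, exists2 s, tensors H B s & mul_tensor s = a).

Definition cofree_for (H : set A) : Prop :=
  [/\ subspace H, stable H & mul_tensor_iso H (invariants setT)].

Definition cofree : Prop := exists H, cofree_for H.

(* Grothendieck's definition: D has order < n when all n-fold commutators
   with multiplication operators vanish. *)
Fixpoint diff_order_lt (n : nat) (D : A -> A) : Prop :=
  if n is n'.+1
  then forall a, diff_order_lt n' (fun f => D (a * f) - a * D f)
  else forall f, D f = 0.

Definition diff_op (D : A -> A) : Prop :=
  linear D /\ exists n, diff_order_lt n D.

Definition invariant_op (D : A -> A) : Prop :=
  forall l f, D (act l f) = act l (D f).

Definition ker_op (D : A -> A) : set A := [set f | D f = 0].

Definition harmonic : Prop :=
  cofree /\
  exists (n : nat) (D : 'I_n -> A -> A),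
    (forall i, diff_op (D i) /\ invariant_op (D i)) /\
    cofree_for (\bigcap_(i in setT) ker_op (D i)).

End Harmonic.

Lemma det2E (R : comNzRingType) (m : 'M[R]_2) :
  \det m = m 0 0 * m 1 1 - m 0 1 * m 1 0.
Proof.
rewrite (expand_det_row m 0) big_ord_recl big_ord1 /cofactor !det_mx11 !mxE /=.
by rewrite expr0 expr1 mul1r mulN1r mulrN; congr (_ * m _ _ - m _ _ * m _ _); apply: val_inj.
Qed.

Lemma mpoly_alg_ind (R : comNzRingType) n (P : {mpoly R[n]} -> Prop) :
  (forall c, P c%:MP) -> (forall i, P 'X_i) ->
  (forall p q, P p -> P q -> P (p + q)) ->
  (forall p q, P p -> P q -> P (p * q)) -> forall p, P p.
Proof.
move=> hC hX hD hM; elim/mpolyind => [|c m p _ _ ih]; first exact: (hC 0).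
apply: (hD) => //; rewrite -mul_mpolyC; apply: (hM) => //.
rewrite mpolyXE_id; apply: (big_ind P); [exact: (hC 1)|exact: (hM)|].
move=> i _; elim: (m i) => [|k ihk]; first exact: (hC 1).
by rewrite exprS; apply: (hM).
Qed.

Section SL2.
Variable K : fieldType.

Record SL2 := MkSL2 { SL2_val :> 'M[K]_2; _ : \det SL2_val == 1 }.

HB.instance Definition _ := [isSub for SL2_val].
HB.instance Definition _ := [Choice of SL2 by <:].

Lemma det_SL2 (g : SL2) : \det g = 1. Proof. by case: g => ? /= /eqP. Qed.

Lemma SL2_unitmx (g : SL2) : (g : 'M_2) \in unitmx.
Proof. by rewrite unitmxE det_SL2 unitr1. Qed.

Fact SL2_one_subproof : \det (1%:M : 'M[K]_2) == 1. Proof. by rewrite det1. Qed.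
Fact SL2_mul_subproof (g h : SL2) : \det ((g : 'M[K]_2) *m h) == 1.
Proof. by rewrite det_mulmx !det_SL2 mulr1. Qed.
Fact SL2_inv_subproof (g : SL2) : \det (invmx g) == 1.
Proof. by rewrite det_inv det_SL2 invr1. Qed.

Definition SL2_one := MkSL2 SL2_one_subproof.
Definition SL2_mul g h := MkSL2 (SL2_mul_subproof g h).
Definition SL2_inv g := MkSL2 (SL2_inv_subproof g).

Fact SL2_mulA : associative SL2_mul.
Proof. by move=> x y z; apply: val_inj; rewrite /= mulmxA. Qed.
Fact SL2_mul1 : left_id SL2_one SL2_mul.
Proof. by move=> x; apply: val_inj; rewrite /= mul1mx. Qed.
Fact SL2_mulr1 : right_id SL2_one SL2_mul.
Proof. by move=> x; apply: val_inj; rewrite /= mulmx1. Qed.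
Fact SL2_mulV : left_inverse SL2_one SL2_inv SL2_mul.
Proof. by move=> x; apply: val_inj; rewrite /= mulVmx ?SL2_unitmx. Qed.
Fact SL2_mulrV : right_inverse SL2_one SL2_inv SL2_mul.
Proof. by move=> x; apply: val_inj; rewrite /= mulmxV ?SL2_unitmx. Qed.

HB.instance Definition _ :=
  isGroup.Build SL2 SL2_mulA SL2_mul1 SL2_mulr1 SL2_mulV SL2_mulrV.

Definition coords (m : 'M[K]_2) : 'I_(2 * 2) -> K := fun k => mxvec m 0 k.

Definition extends (f : SL2 -> K) (p : {mpoly K[2 * 2]}) : Prop :=
  forall g : SL2, f g = p.@[coords g].

Definition regular_pred : {pred SL2 -> K} :=
  [pred f | `[< exists p, extends f p >]].

Lemma regularP (f : SL2 -> K) :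
  reflect (exists p, extends f p) (f \in regular_pred).
Proof. exact: asboolP. Qed.

Fact regular_cst (c : K) : (fun=> c) \in regular_pred.
Proof. by apply/regularP; exists c%:MP => g; rewrite mevalC. Qed.

Fact regular_subring_closed : subring_closed regular_pred.
Proof.
split; first exact: regular_cst.
- move=> u v /regularP[p hp] /regularP[q hq].
  by apply/regularP; exists (p - q) => g; rewrite mevalB -hp -hq.
- move=> u v /regularP[p hp] /regularP[q hq].
  by apply/regularP; exists (p * q) => g; rewrite mevalM -hp -hq.
Qed.

HB.instance Definition _ := GRing.isSubringClosed.Build (SL2 -> K) regular_pred
  regular_subring_closed.

Record regfun :=
  Regfun { regfun_val :> SL2 -> K; regfunP : regfun_val \in regular_pred }.

HB.instance Definition _ := [isSub for regfun_val].
HB.instance Definition _ := [Choice of regfun by <:].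
HB.instance Definition _ := [SubChoice_isSubZmodule of regfun by <:].
HB.instance Definition _ := GRing.SubZmodule_isSubPzRing.Build
  (SL2 -> K) regular_pred regfun regular_subring_closed.
HB.instance Definition _ := GRing.SubPzRing_isSubComPzRing.Build _ _ regfun.

Lemma regfun_eqP (f h : regfun) : (forall g, f g = h g) <-> f = h.
Proof. by split=> [fh|->//]; apply: val_inj; apply/funext. Qed.

Fact regfun1_neq0 : 1 != 0 :> regfun.
Proof.
apply/eqP => /regfun_eqP/(_ SL2_one) /eqP.
by rewrite (_ : regfun_val 1 _ = 1) // oner_eq0.
Qed.

HB.instance Definition _ := GRing.PzSemiRing_isNonZero.Build regfun regfun1_neq0.

Definition regfun_cst (c : K) : regfun := Regfun (regular_cst c).

Definition regfun_scale (c : K) (f : regfun) : regfun := regfun_cst c * f.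

Fact regfun_scaleA a b f :
  regfun_scale a (regfun_scale b f) = regfun_scale (a * b) f.
Proof. by rewrite /regfun_scale mulrA; congr (_ * _); apply/val_inj. Qed.
Fact regfun_scale1 : left_id 1 regfun_scale.
Proof. by move=> f; rewrite -[RHS]mul1r; congr (_ * _); apply/val_inj. Qed.
Fact regfun_scaleDr : right_distributive regfun_scale +%R.
Proof. by move=> c f h; rewrite /regfun_scale mulrDr. Qed.
Fact regfun_scaleDl f : {morph regfun_scale^~ f : a b / a + b}.
Proof.
by move=> a b; rewrite /regfun_scale -mulrDl; congr (_ * _); apply/val_inj.
Qed.

HB.instance Definition _ := GRing.Zmodule_isLmodule.Build K regfun
  regfun_scaleA regfun_scale1 regfun_scaleDr regfun_scaleDl.

Fact regfun_scaleAl (c : K) (f h : regfun) : c *: (f * h) = c *: f * h.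
Proof. exact: mulrA. Qed.

HB.instance Definition _ :=
  GRing.Lmodule_isLalgebra.Build K regfun regfun_scaleAl.
HB.instance Definition _ := GRing.Lalgebra_isComAlgebra.Build K regfun.

Lemma regfunD (f h : regfun) g : (f + h) g = f g + h g. Proof. by []. Qed.
Lemma regfunM (f h : regfun) g : (f * h) g = f g * h g. Proof. by []. Qed.
Lemma regfunZ (c : K) (f : regfun) g : (c *: f) g = c * f g. Proof. by []. Qed.

Fact regular_entry i j : (fun g : SL2 => g i j) \in regular_pred.
Proof.
by apply/regularP; exists 'X_(mxvec_index i j) => g; rewrite mevalXU /coords mxvecE.
Qed.

Definition entry (i j : 'I_2) : regfun := Regfun (regular_entry i j).

Lemma regular_sum (I : Type) (r : seq I) (F : I -> SL2 -> K) :
  (forall i, F i \in regular_pred) ->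
  (fun g => \sum_(i <- r) F i g) \in regular_pred.
Proof. by move=> h; rewrite -fct_sumE; apply: rpred_sum. Qed.

Lemma regular_meval n (p : {mpoly K[n]}) (v : 'I_n -> SL2 -> K) :
  (forall k, v k \in regular_pred) ->
  (fun g => p.@[v^~ g]) \in regular_pred.
Proof.
move=> h.
rewrite (_ : (fun _ => _) = \sum_(m <- msupp p)
   ((fun=> p@_m) * \prod_i (v i ^+ m i) : SL2 -> K)); last first.
  apply/funext => g; rewrite mevalE fct_sumE; apply: eq_bigr => m _.
  congr (_ * _); rewrite fct_prodE; apply: eq_bigr => i _.
  by elim: (m i) => // k ih; rewrite !exprS ih.
apply: rpred_sum => m _; apply: rpredM; first exact: regular_cst.
by apply: rpred_prod => i _; apply: rpredX.
Qed.

Definition regular_map (X : SL2 -> 'M[K]_2) : Prop :=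
  forall i j, (fun g => X g i j) \in regular_pred.

Lemma regular_coords X : regular_map X ->
  forall k, (fun g => coords (X g) k) \in regular_pred.
Proof.
move=> hX k; case/mxvec_indexP: k => i j.
by under eq_fun do rewrite /coords mxvecE.
Qed.

Lemma regular_map_id : regular_map (fun g => g).
Proof. exact: regular_entry. Qed.

Lemma regular_map_cst m : regular_map (fun=> m).
Proof. by move=> i j; apply: regular_cst. Qed.

Lemma regular_mapM X Y : regular_map X -> regular_map Y ->
  regular_map (fun g => X g *m Y g).
Proof.
move=> hX hY i j.
under eq_fun do rewrite mxE.
apply: regular_sum => k.
by rewrite (_ : (fun _ => _) = (fun g => X g i k) * (fun g => Y g k j)) // rpredM.
Qed.

Lemma regular_mapB X Y : regular_map X -> regular_map Y ->
  regular_map (fun g => X g - Y g).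
Proof.
move=> hX hY i j.
rewrite (_ : (fun _ => _) = (fun g => X g i j) - (fun g => Y g i j)) ?rpredB //.
by apply/funext => g; rewrite !mxE.
Qed.

Lemma SL2_inv_adj (g : SL2) : invmx g = \adj g :> 'M[K]_2.
Proof. by rewrite /invmx SL2_unitmx det_SL2 invr1 scale1r. Qed.

Lemma regular_map_inv : regular_map (fun g => (g^-1)%g : SL2).
Proof.
move=> i j.
rewrite (_ : (fun _ => _) = (fun=> (-1) ^+ (j + i)) *
   (fun g : SL2 => g (lift j 0) (lift i 0))); last first.
  by apply/funext => g; rewrite /= SL2_inv_adj mxE /cofactor det_mx11 !mxE.
by apply: rpredM; [apply: regular_cst | apply: regular_entry].
Qed.

End SL2.

Section VectorFields.
Variable K : numFieldType.
Notation SL2 := (SL2 K).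
Notation regfun := (regfun K).

Definition line (x v : 'M[K]_2) : 'I_(2 * 2) -> {poly K} :=
  fun k => (coords x k)%:P + coords v k *: 'X.

(* d/dt p(x + t v) at t = 0, the derivative being formal since p is polynomial *)
Definition dder (p : {mpoly K[2 * 2]}) (x v : 'M[K]_2) : K :=
  (mmap (@polyC K) (line x v) p)^`().[0].

Lemma mmap_line p x v t :
  (mmap (@polyC K) (line x v) p).[t] = p.@[coords (x + t *: v)].
Proof.
rewrite mevalE /mmap horner_sum; apply: eq_bigr => m _.
rewrite hornerM hornerC; congr (_ * _); rewrite /mmap1 horner_prod.
apply: eq_bigr => i _; rewrite horner_exp /line !hornerE; congr (_ ^+ _).
by rewrite /coords linearD linearZ !mxE mulrC.
Qed.

Lemma dderD p q x v : dder (p + q) x v = dder p x v + dder q x v.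
Proof. by rewrite /dder mmapD derivD hornerD. Qed.

Lemma dderM p q x v :
  dder (p * q) x v = dder p x v * q.@[coords x] + p.@[coords x] * dder q x v.
Proof.
have h r : r.@[coords x] = (mmap (@polyC K) (line x v) r).[0].
  by rewrite mmap_line scale0r addr0.
by rewrite /dder rmorphM derivM hornerD !hornerM !h.
Qed.

Lemma dderC c x v : dder c%:MP x v = 0.
Proof. by rewrite /dder mmapC derivC horner0. Qed.

Lemma dderX i x v : dder 'X_i x v = coords v i.
Proof.
by rewrite /dder mmapX mmap1U /line derivD derivC add0r derivZ derivX !hornerE.
Qed.

Lemma dderE p x v :
  dder p x v = \sum_k coords v k * (p^`M(k)).@[coords x].
Proof.
elim/mpoly_alg_ind: p => [c|i|p q hp hq|p q hp hq].
- by rewrite dderC big1 // => k _; rewrite mderivC meval0 mulr0.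
- rewrite dderX (bigD1 i) //= big1 => [|k ki].
    rewrite mderivX mnm1E eqxx scale1r mevalX addr0.
    by rewrite big1 ?mulr1 // => j _; rewrite mnmBE subnn.
  by rewrite mderivX mnm1E eq_sym (negPf ki) scale0r meval0 mulr0.
- rewrite dderD hp hq -big_split /=; apply: eq_bigr => k _.
  by rewrite mderivD mevalD mulrDr.
- rewrite dderM hp hq mulr_suml mulr_sumr -big_split /=; apply: eq_bigr => k _.
  by rewrite mderivM mevalD !mevalM; ring.
Qed.

Lemma coordsP (a : K) u v k : coords (a *: u + v) k = a * coords u k + coords v k.
Proof. by rewrite /coords linearP !mxE. Qed.

Lemma dder_linear p x a u v :
  dder p x (a *: u + v) = a * dder p x u + dder p x v.
Proof.
rewrite !dderE mulr_sumr -big_split /=; apply: eq_bigr => k _.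
by rewrite coordsP mulrDl mulrA.
Qed.

Lemma poly_vanish (P : {poly K}) : (forall t, P.[t] = 0) -> P = 0.
Proof.
move=> h; apply/eqP/negPn/negP => P0.
have := @max_poly_roots _ P [seq i%:R | i <- iota 0 (size P)] P0.
rewrite size_map size_iota ltnn => H; suff: false by []; apply: H.
  by apply/allP => x _; apply/rootP.
by rewrite map_inj_uniq ?iota_uniq // => i j /eqP; rewrite eqr_nat => /eqP.
Qed.

Lemma dder_nilp p (g : SL2) (n : 'M[K]_2) : (forall h : SL2, p.@[coords h] = 0) ->
  n 1 1 = - n 0 0 -> n 0 1 * n 1 0 = - n 0 0 ^+ 2 ->
  dder p g (g *m n) = 0.
Proof.
move=> h0 n1 n2; rewrite /dder (_ : mmap _ _ _ = 0) ?deriv0 ?horner0 //.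
apply: poly_vanish => t; rewrite mmap_line.
have hd : \det ((g : 'M_2) *m (1%:M + t *: n)) == 1.
  rewrite det_mulmx det_SL2 mul1r det2E !mxE /= n1.
  rewrite ?mulr1n ?mulr0n !add0r -mulrACA n2; apply/eqP; ring.
by rewrite -(h0 (MkSL2 hd)) /= mulmxDr mulmx1 -scalemxAr.
Qed.

Lemma mx2P (a b : 'M[K]_2) : a 0 0 = b 0 0 -> a 0 1 = b 0 1 ->
  a 1 0 = b 1 0 -> a 1 1 = b 1 1 -> a = b.
Proof.
move=> h00 h01 h10 h11; apply/matrixP=> i j.
have o2 (k : 'I_2) : k = 0 \/ k = 1.
  by case: k => -[|[|//]] hk; [left|right]; apply: val_inj.
by case: (o2 i) => ->; case: (o2 j) => ->.
Qed.

Lemma mxtrace2E (m : 'M[K]_2) : \tr m = m 0 0 + m 1 1.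
Proof.
by rewrite /mxtrace big_ord_recl big_ord1; congr (_ + m _ _); apply: val_inj.
Qed.

Lemma dder_ext p q (g : SL2) (X : 'M[K]_2) : \tr X = 0 ->
  (forall h : SL2, p.@[coords h] = q.@[coords h]) ->
  dder p g (g *m X) = dder q g (g *m X).
Proof.
move=> trX hpq; pose r := p + (-1)%:MP * q.
have hr (h : SL2) : r.@[coords h] = 0.
  by rewrite /r mevalD mevalM mevalC hpq mulN1r subrr.
suff: dder r g (g *m X) = 0.
  rewrite /r dderD dderM dderC mul0r add0r mevalC mulN1r => /eqP.
  by rewrite subr_eq0 => /eqP.
pose N : 'M[K]_2 := \matrix_(i, j) (if j == 0 then 1 else -1).
pose E : 'M[K]_2 := delta_mx 0 1.
pose F : 'M[K]_2 := delta_mx 1 0.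
have h11 : X 1 1 = - X 0 0.
  by apply/eqP; rewrite -addr_eq0 addrC -mxtrace2E trX.
have -> : X = X 0 0 *: N + ((X 0 1 + X 0 0) *: E + ((X 1 0 - X 0 0) *: F + 0)).
  by apply: mx2P; rewrite !mxE /= ?h11; ring.
rewrite !(mulmxDr, mulmx0) -!scalemxAr !dder_linear.
have d0 : dder r g 0 = 0.
  by rewrite dderE big1 // => k _; rewrite /coords linear0 mxE mul0r.
by rewrite d0 !dder_nilp ?mulr0 ?addr0 // !mxE /=; ring.
Qed.

Lemma regular_dder p (V : SL2 -> 'M[K]_2) :
  regular_map V -> (fun g : SL2 => dder p g (V g)) \in @regular_pred K.
Proof.
move=> hV; under eq_fun do rewrite dderE.
apply: regular_sum => k.
rewrite (_ : (fun _ => _) = (fun g => coords (V g) k) *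
   (fun g : SL2 => p^`M(k).@[coords g])) //.
apply: rpredM; first exact: regular_coords.
by apply: regular_meval => j; apply: regular_coords; apply: regular_map_id.
Qed.

Definition extension (f : regfun) : {mpoly K[2 * 2]} :=
  projT1 (cid (elimT (regularP f) (regfunP f))).

Lemma extensionP (f : regfun) : extends f (extension f).
Proof. by rewrite /extension; case: cid. Qed.

(* The vector field (f |-> d/dt f(g + t g X(g)) at t = 0); for X with values in
   sl2 it does not depend on the choice of the extension of f, see [vfieldE]. *)
Definition vfield X (hX : regular_map X) (f : regfun) : regfun :=
  Regfun (regular_dder (extension f) (regular_mapM (@regular_map_id K) hX)).

Section Derivation.
Variables (X : SL2 -> 'M[K]_2) (hX : regular_map X).
Hypothesis trX : forall g, \tr (X g) = 0.

Lemma vfieldE (f : regfun) p g : extends f p ->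
  vfield hX f g = dder p g (g *m X g).
Proof. by move=> hp; apply: dder_ext => // h; rewrite -extensionP hp. Qed.

Lemma vfieldD f h : vfield hX (f + h) = vfield hX f + vfield hX h.
Proof.
apply/regfun_eqP => g; rewrite regfunD.
rewrite (@vfieldE _ (extension f + extension h)) ?dderD // => y.
by rewrite regfunD mevalD -!extensionP.
Qed.

Lemma vfieldM f h : vfield hX (f * h) = vfield hX f * h + f * vfield hX h.
Proof.
apply/regfun_eqP => g; rewrite regfunD !regfunM.
rewrite (@vfieldE _ (extension f * extension h)) ?dderM -?extensionP // => y.
by rewrite regfunM mevalM -!extensionP.
Qed.

Lemma vfield_entry i j g : vfield hX (entry K i j) g = (g *m X g) i j.
Proof.
rewrite (@vfieldE _ 'X_(mxvec_index i j)) ?dderX /coords ?mxvecE // => y.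
by rewrite mevalXU /coords mxvecE.
Qed.
End Derivation.

Lemma regular_trace : (fun g : SL2 => \tr g) \in @regular_pred K.
Proof. by apply: regular_sum => i; apply: regular_entry. Qed.

Definition trfun : regfun := Regfun regular_trace.

Definition Psi_dir (g : SL2) : 'M[K]_2 := SL2_val g - SL2_val (g^-1)%g.

Lemma regular_Psi_dir : regular_map Psi_dir.
Proof. by apply: regular_mapB; [apply: regular_map_id | apply: regular_map_inv]. Qed.

Definition Psi : regfun -> regfun := vfield regular_Psi_dir.

(* The left-invariant vector field f |-> d/dt f(g (1 + t m)) at t = 0. *)
Definition lie (m : 'M[K]_2) : regfun -> regfun := vfield (regular_map_cst m).

Definition sl2E : 'M[K]_2 := delta_mx 0 1.
Definition sl2F : 'M[K]_2 := delta_mx 1 0.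
Definition sl2H : 'M[K]_2 := delta_mx 0 0 - delta_mx 1 1.

(* H^2 + 2 (E F + F E); see [casimir_matcoef] for the normalization. *)
Definition Delta (f : regfun) : regfun :=
  lie sl2H (lie sl2H f) + 2%:R * (lie sl2E (lie sl2F f) + lie sl2F (lie sl2E f)).

Definition opD (f : regfun) : regfun :=
  - trfun ^+ 3 * Delta f + trfun * Psi (Psi f) + (trfun ^+ 2 + 4%:R) * Psi f.

Lemma regular_conj (x : SL2) (f : regfun) :
  (fun g : SL2 => f (g ^ x)%g) \in @regular_pred K.
Proof.
under eq_fun do rewrite extensionP.
apply: regular_meval => k; apply: regular_coords.
apply: regular_mapM; first exact: regular_map_cst.
by apply: regular_mapM; [apply: regular_map_id | apply: regular_map_cst].
Qed.

(* In groupType, g ^ x = x^-1 g x. *)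
Definition conj_act (x : SL2) (f : regfun) : regfun := Regfun (regular_conj x f).

Definition lower_unipotent : set SL2 :=
  [set x | [/\ x 0 0 = 1, x 1 1 = 1 & x 0 1 = 0]].

(* The coefficient of x^(d-j) y^j in g (x^(d-i) y^i), a matrix coefficient of
   S^d V for V = <x, y>; we compute at x = 1, y = 'X. *)
Definition matcoef (d i j : nat) : regfun :=
  (((entry K 0 0)%:P + (entry K 1 0)%:P * 'X) ^+ (d - i) *
   ((entry K 0 1)%:P + (entry K 1 1)%:P * 'X) ^+ i)`_j.

Section PolyDerivation.
Variable B : comNzRingType.
Definition derivation (D : B -> B) :=
  (forall u v, D (u + v) = D u + D v) /\
  (forall u v, D (u * v) = D u * v + u * D v).

Lemma derivation0 D : derivation D -> D 0 = 0.
Proof. by case=> hD _; apply: (@addIr _ (D 0)); rewrite -hD !add0r. Qed.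

Lemma derivationX D u n : derivation D -> D (u ^+ n.+1) = (n.+1)%:R * u ^+ n * D u.
Proof.
move=> [_ hM]; elim: n => [|n ih]; first by rewrite expr1 expr0 !mul1r.
by rewrite exprS hM ih -[n.+2%:R]natr1 exprS; ring.
Qed.

Lemma derivation_sum D I (r : seq I) (F : I -> B) : derivation D ->
  D (\sum_(i <- r) F i) = \sum_(i <- r) D (F i).
Proof.
move=> hD; elim: r => [|i r ih]; first by rewrite !big_nil derivation0.
by rewrite !big_cons hD.1 ih.
Qed.

Lemma derivation1 D : derivation D -> D 1 = 0.
Proof.
by case=> _ hM; apply: (@addIr _ (D 1)); rewrite add0r -{3}(mulr1 1) hM mulr1 mul1r.
Qed.

Lemma derivation_nat D n : derivation D -> D n%:R = 0.
Proof.
move=> hD; elim: n => [|n ih]; first exact: derivation0.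
by rewrite -natr1 hD.1 ih derivation1 // addr0.
Qed.

Lemma derivationN D u : derivation D -> D (- u) = - D u.
Proof.
by move=> hD; apply: (@addIr _ (D u)); rewrite -hD.1 !addNr derivation0.
Qed.
End PolyDerivation.

Lemma derivation_poly (B : comNzRingType) (D : B -> B) :
  derivation D -> derivation (map_poly D).
Proof.
move=> hD; have D0 := derivation0 hD.
have cD p i : (map_poly D p)`_i = D p`_i by rewrite coef_map_id0.
split=> u v; apply/polyP => i.
  by rewrite coefD !cD coefD hD.1.
rewrite coefD cD !coefM derivation_sum // -big_split /=; apply: eq_bigr => k _.
by rewrite !cD hD.2.
Qed.

Lemma derivation_lie m : \tr m = 0 -> derivation (lie m).
Proof. by move=> h; split=> u v; [apply: vfieldD | apply: vfieldM]. Qed.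

Lemma lie_entry m i j : \tr m = 0 ->
  lie m (entry K i j) = \sum_k m k j *: entry K i k.
Proof.
move=> trm; apply/regfun_eqP => g; rewrite vfield_entry // mxE.
rewrite (_ : regfun_val _ g = \sum_k (m k j *: entry K i k) g).
  by apply: eq_bigr => k _; rewrite regfunZ mulrC.
by elim/big_rec2: _ => // k y1 y2 _ <-.
Qed.

Lemma casimir_matcoef d i j : (i <= d)%N ->
  Delta (matcoef d i j) = (d * (d + 2))%:R * matcoef d i j.
Proof.
move=> le_id; rewrite /matcoef.
set al := _ + _ * 'X; set be := _ + _ * 'X.
pose D m := map_poly (lie m).
have tE : \tr sl2E = 0 by rewrite mxtrace2E !mxE addr0.
have tF : \tr sl2F = 0 by rewrite mxtrace2E !mxE addr0.
have tH : \tr sl2H = 0 by rewrite mxtrace2E !mxE /= !mulr1n !mulr0n; ring.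
have dD m : \tr m = 0 -> derivation (D m).
  by move=> h; apply/derivation_poly/derivation_lie.
have cD m p k : \tr m = 0 -> (D m p)`_k = lie m p`_k.
  by move=> h; rewrite coef_map_id0 // (derivation0 (derivation_lie h)).
have DX m a b : \tr m = 0 -> D m (a%:P + b%:P * 'X) = (lie m a)%:P + (lie m b)%:P * 'X.
  move=> h; apply/polyP => k; rewrite cD // !coefD !coefMX !coefC.
  have l0 := derivation0 (derivation_lie h).
  by case: k => [|[|k]] /=; rewrite ?addr0 ?add0r ?l0.
have sum2 (F : 'I_2 -> regfun) : \sum_k F k = F 0 + F 1.
  by rewrite big_ord_recl big_ord1; congr (_ + F _); apply: val_inj.
have L m i0 j0 : \tr m = 0 -> lie m (entry K i0 j0) =
    m 0 j0 *: entry K i0 0 + m 1 j0 *: entry K i0 1.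
  by move=> h; rewrite lie_entry // sum2.
have [H00 H01 H10 H11] : [/\ sl2H 0 0 = 1, sl2H 0 1 = 0, sl2H 1 0 = 0 & sl2H 1 1 = -1].
  by split; rewrite !mxE /= ?mulr1n ?mulr0n; ring.
have [E00 E01 E10 E11] : [/\ sl2E 0 0 = 0, sl2E 0 1 = 1, sl2E 1 0 = 0 & sl2E 1 1 = 0].
  by split; rewrite !mxE.
have [F00 F01 F10 F11] : [/\ sl2F 0 0 = 0, sl2F 0 1 = 0, sl2F 1 0 = 1 & sl2F 1 1 = 0].
  by split; rewrite !mxE.
have lH0 i0 : lie sl2H (entry K i0 0) = entry K i0 0.
  by rewrite (L _ _ _ tH) H00 H10 scale1r scale0r addr0.
have lH1 i0 : lie sl2H (entry K i0 1) = - entry K i0 1.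
  by rewrite (L _ _ _ tH) H01 H11 scaleN1r scale0r add0r.
have lE0 i0 : lie sl2E (entry K i0 0) = 0.
  by rewrite (L _ _ _ tE) E00 E10 !scale0r addr0.
have lE1 i0 : lie sl2E (entry K i0 1) = entry K i0 0.
  by rewrite (L _ _ _ tE) E01 E11 scale0r scale1r addr0.
have lF0 i0 : lie sl2F (entry K i0 0) = entry K i0 1.
  by rewrite (L _ _ _ tF) F00 F10 scale0r scale1r add0r.
have lF1 i0 : lie sl2F (entry K i0 1) = 0.
  by rewrite (L _ _ _ tF) F01 F11 !scale0r addr0.
have HA : D sl2H al = al by rewrite (DX _ _ _ tH) !lH0.
have HB : D sl2H be = - be by rewrite (DX _ _ _ tH) !lH1 !polyCN mulNr opprD.
have EA : D sl2E al = 0 by rewrite (DX _ _ _ tE) !lE0 mul0r addr0.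
have EB : D sl2E be = al by rewrite (DX _ _ _ tE) !lE1.
have FA : D sl2F al = be by rewrite (DX _ _ _ tF) !lF0.
have FB : D sl2F be = 0 by rewrite (DX _ _ _ tF) !lF1 mul0r addr0.
pose CD p := D sl2H (D sl2H p) +
  2%:R * (D sl2E (D sl2F p) + D sl2F (D sl2E p)).
have cCD p k : (CD p)`_k = Delta p`_k.
  by rewrite /CD coefD mulr_natl coefMn coefD !cD // /Delta mulr_natl.
rewrite -cCD mulr_natl -coefMn; congr ((polyseq _)`_j).
set a := (d - i)%N; have <- : (a + i)%N = d by rewrite /a subnK.
rewrite /CD; move: a => a; move: (dD _ tH) (dD _ tE) (dD _ tF).
move: (D sl2H) (D sl2E) (D sl2F) HA HB EA EB FA FB => H E F.
move: al be => {cCD CD} al be HA HB EA EB FA FB dH dE dF.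
have uH p q : H (al ^+ p * be ^+ q) = (p%:R - q%:R) * (al ^+ p * be ^+ q).
  rewrite dH.2; case: p q => [|p] [|q];
    rewrite ?(derivationX _ _ dH) ?expr0 ?HA ?HB ?(exprS _ p) ?(exprS _ q);
    rewrite ?[H 1](derivation1 dH); ring.
have uE p q : E (al ^+ p * be ^+ q) = q%:R * (al ^+ p.+1 * be ^+ q.-1).
  rewrite dE.2; case: p q => [|p] [|q];
    rewrite ?(derivationX _ _ dE) ?expr0 ?EA ?EB ?(exprS _ p) ?(exprS _ q);
    rewrite ?[E 1](derivation1 dE) /= ?exprS; ring.
have uF p q : F (al ^+ p * be ^+ q) = p%:R * (al ^+ p.-1 * be ^+ q.+1).
  rewrite dF.2; case: p q => [|p] [|q];
    rewrite ?(derivationX _ _ dF) ?expr0 ?FA ?FB ?(exprS _ p) ?(exprS _ q);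
    rewrite ?[F 1](derivation1 dF) /= ?exprS; ring.
have hnat n D0 u : derivation D0 -> D0 (n%:R * u) = n%:R * D0 u.
  by move=> h; rewrite h.2 (derivation_nat _ h) mul0r add0r.
have uHH : H (H (al ^+ a * be ^+ i)) = (a%:R - i%:R) ^+ 2 * (al ^+ a * be ^+ i).
  rewrite [X in H X]uH mulrBl dH.1 -mulNr.
  have -> : - i%:R * (al ^+ a * be ^+ i) = i%:R * (- (al ^+ a * be ^+ i)) by ring.
  rewrite !(hnat _ _ H _ dH) (derivationN _ dH) uH; ring.
have uEF : E (F (al ^+ a * be ^+ i)) = (a * i.+1)%:R * (al ^+ a * be ^+ i).
  rewrite uF (hnat _ _ E _ dE) uE /= natrM; clear uHH; case: a => [|a] /=; last by ring.
  by rewrite !mul0r.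
have uFE : F (E (al ^+ a * be ^+ i)) = (i * a.+1)%:R * (al ^+ a * be ^+ i).
  rewrite uE (hnat _ _ F _ dF) uF /= natrM; clear uHH uEF le_id; case: i => [|i] /=; last by ring.
  by rewrite !mul0r.
rewrite uHH uEF uFE -[RHS]mulr_natl !natrM !natrD; ring.
Qed.

End VectorFields.

(* Main.v *)
Require Import Defs.
From HB Require Import structures.
From mathcomp Require Import all_boot all_order all_algebra.
From mathcomp Require Import mpoly complex boolp classical_sets reals.
From mathcomp Require Import ring.

(* Put t = tr g and, for a vector v = (1, s), ell = det (g v, v), a polynomial of
   degree 2 in s; let harm n k be the coefficient of s^k in ell^n. Since ell is
   isotropic for the Casimir form, Psi (harm n k) = n t harm n k and
   Delta (harm n k) = n (n + 2) harm n k, whence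
     D (harm n k * p(t)) = harm n k * (radial n p)(t)
   for a second order ordinary differential operator radial n whose polynomial
   kernel is the constants. The functions harm n k, k <= 2n, form a basis of C[G]
   over C[t]: they span because (ell^(n+1))', (ell^(n+1))'' and the discriminant
   t^2 - 4 of ell express b ell^n, (a - d) ell^n and c ell^n; they are independent
   because conjugation by a lower unipotent element translates s, which reduces
   the question to the powers of b = harm 1 2. Hence ker D is the span of the
   harm n k, C[G] = ker D (x) C[t], and C[t] is the ring of invariants. *)

Set Implicit Arguments.
Unset Strict Implicit.
Unset Printing Implicit Defensive.

Import GRing.Theory Num.Theory.
Local Open Scope classical_set_scope.
Local Open Scope ring_scope.

Lemma ord2P (i : 'I_2) : i = 0 \/ i = 1.
Proof. by case: i => -[|[|//]] hi; [left|right]; apply: val_inj. Qed.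

Lemma sum2E (V : nmodType) (F : 'I_2 -> V) : \sum_i F i = F 0 + F 1.
Proof. by rewrite big_ord_recl big_ord1; congr (_ + F _); apply: val_inj. Qed.

(** * Regular functions: generation by the matrix entries *)

Section RegularFunctions.
Variable K : fieldType.
Notation regfun := (regfun K).

(** Each regular function extends to a polynomial in the four entries, so this is induction on
    polynomials. *)
Lemma regfun_ind (P : regfun -> Prop) :
  (forall c, P (c *: 1)) -> (forall i j, P (entry K i j)) ->
  (forall f h, P f -> P h -> P (f + h)) ->
  (forall f h, P f -> P h -> P (f * h)) -> forall f, P f.
Proof.
move=> hC hX hD hM.
suff key p : forall f : regfun, extends f p -> P f.
  by move=> f; have /regularP[p] := regfunP f; apply: key.
have reg q : (fun g : SL2 K => q.@[coords g]) \in @regular_pred K.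
  by apply/regularP; exists q.
elim/mpoly_alg_ind: p => [c|k|p q hp hq|p q hp hq] f hf.
- suff -> : f = c *: 1 by [].
  by apply/regfun_eqP => g; rewrite hf mevalC regfunZ (_ : regfun_val 1 g = 1) ?mulr1.
- case/mxvec_indexP: k hf => i j hf; suff -> : f = entry K i j by [].
  by apply/regfun_eqP => g; rewrite hf mevalXU /coords mxvecE.
- suff -> : f = Regfun (reg p) + Regfun (reg q) by apply: hD; [apply: hp|apply: hq].
  by apply/regfun_eqP => g; rewrite hf regfunD mevalD.
- suff -> : f = Regfun (reg p) * Regfun (reg q) by apply: hM; [apply: hp|apply: hq].
  by apply/regfun_eqP => g; rewrite hf regfunM mevalM.
Qed.

Lemma regfun1 g : (1 : regfun) g = 1. Proof. by []. Qed.

Lemma regfunN (f : regfun) g : (- f) g = - f g. Proof. by []. Qed.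

Lemma regfunB (f h : regfun) g : (f - h) g = f g - h g. Proof. by []. Qed.

Lemma regfunX (f : regfun) n g : (f ^+ n) g = f g ^+ n.
Proof. by elim: n => [|n ih] //; rewrite !exprS regfunM ih. Qed.

Lemma regfun_sum I (r : seq I) (P : pred I) (F : I -> regfun) g :
  (\sum_(i <- r | P i) F i) g = \sum_(i <- r | P i) F i g.
Proof. by apply: (big_morph (fun f : regfun => f g)). Qed.

Lemma entry_det : entry K 0 0 * entry K 1 1 = 1 + entry K 0 1 * entry K 1 0.
Proof.
apply/regfun_eqP => g; rewrite regfunD !regfunM regfun1 /= -(det_SL2 g) det2E.
by rewrite subrK.
Qed.

End RegularFunctions.

(** * Vector fields as derivations determined by the entries *)

Section InvariantFields.
Variable K : numFieldType.
Notation regfun := (regfun K).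
Notation SL2 := (SL2 K).

Lemma SL2_invE (g : SL2) : [/\ SL2_val (g^-1)%g 0 0 = g 1 1,
  SL2_val (g^-1)%g 0 1 = - g 0 1, SL2_val (g^-1)%g 1 0 = - g 1 0
  & SL2_val (g^-1)%g 1 1 = g 0 0].
Proof.
have -> : SL2_val (g^-1)%g = \adj (SL2_val g) by apply: SL2_inv_adj.
split; rewrite !mxE /cofactor det_mx11 !mxE /= ?expr0 ?expr1 ?sqrr_sign ?mul1r ?mulN1r.
- by congr (SL2_val g _ _); apply: val_inj.
- by congr (- SL2_val g _ _); apply: val_inj.
- by congr (- SL2_val g _ _); apply: val_inj.
- by rewrite expr2 mulrNN !mul1r; congr (SL2_val g _ _); apply: val_inj.
Qed.

Section Fields.
Variables (X : SL2 -> 'M[K]_2) (hX : regular_map X).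
Hypothesis trX : forall g, \tr (X g) = 0.

Lemma vfieldZ c f : vfield hX (c *: f) = c *: vfield hX f.
Proof.
apply/regfun_eqP => g; rewrite regfunZ (@vfieldE _ _ hX trX _ (c%:MP * extension f)).
  by rewrite dderM dderC mul0r add0r mevalC.
by move=> y; rewrite mevalM mevalC -extensionP regfunZ.
Qed.

End Fields.

(** Both maps are derivations along [s], hence determined by their values on the generators. The
    case [s = id] compares vector fields on G; the case [s = conj_act x] proves their
    equivariance. *)
Lemma derivation_comp_ext (s : regfun -> regfun) (d1 d2 : regfun -> regfun) :
    {morph s : f h / f * h} -> s 1 = 1 ->
    (forall f h, d1 (f + h) = d1 f + d1 h) -> (forall f h, d2 (f + h) = d2 f + d2 h) ->
    (forall c f, d1 (c *: f) = c *: d1 f) -> (forall c f, d2 (c *: f) = c *: d2 f) ->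
    (forall f h, d1 (f * h) = d1 f * s h + s f * d1 h) ->
    (forall f h, d2 (f * h) = d2 f * s h + s f * d2 h) ->
    (forall i j, d1 (entry K i j) = d2 (entry K i j)) ->
  d1 =1 d2.
Proof.
move=> sM s1 D1 D2 Z1 Z2 M1 M2 e f.
elim/regfun_ind: f => [c|//|f h hf hh|f h hf hh].
- rewrite Z1 Z2; congr (_ *: _).
  have z (d : regfun -> regfun) : (forall f h, d (f * h) = d f * s h + s f * d h) -> d 1 = 0.
    by move=> M; apply: (@addIr _ (d 1)); rewrite add0r -{3}(mulr1 1) M s1 mulr1 mul1r.
  by rewrite !z.
- by rewrite D1 D2 hf hh.
- by rewrite M1 M2 hf hh.
Qed.

End InvariantFields.

(** * Linear hulls and maps that are bilinear on subspaces *)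

Section LinHull.
Variables (K : fieldType) (A : comAlgType K).

Lemma subspaceZ (V : set A) k u : subspace V -> V u -> V (k *: u).
Proof. by move=> [V0 VP] Vu; rewrite -[_ *: u]addr0; apply: VP. Qed.

Lemma subspace_sum (V : set A) I (r : seq I) (F : I -> A) :
  subspace V -> (forall i, V (F i)) -> V (\sum_(i <- r) F i).
Proof.
move=> [V0 VP] h; elim: r => [|i r ih]; first by rewrite big_nil.
by rewrite big_cons -[F i]scale1r; apply: VP.
Qed.

Lemma lin_hull_min (S V : set A) : subspace V -> S `<=` V -> lin_hull S `<=` V.
Proof.
move=> sV SV _ [s hs ->]; elim: s hs => [|x s ih] hs; first by rewrite big_nil; apply: sV.1.
rewrite big_cons; apply: sV.2; first by apply/SV/hs/mem_head.
by apply: ih => y ys; apply: hs; rewrite inE ys orbT.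
Qed.

Section Bilinear.
Variables (H B : set A) (W : lmodType K) (phi : A -> A -> W).
Hypotheses (sH : subspace H) (sB : subspace B) (bphi : bilinear_on H B phi).

Lemma bilinear0l y : B y -> phi 0 y = 0.
Proof.
move=> By; have := bphi.1 1 0 0 y sH.1 sH.1 By; rewrite !scale1r addr0 => h.
by apply: (@addIr _ (phi 0 y)); rewrite add0r -h.
Qed.

Lemma bilinear0r h : H h -> phi h 0 = 0.
Proof.
move=> Hh; have := bphi.2 1 h 0 0 Hh sB.1 sB.1; rewrite !scale1r addr0 => e.
by apply: (@addIr _ (phi h 0)); rewrite add0r -e.
Qed.

Lemma bilinearZl k h y : H h -> B y -> phi (k *: h) y = k *: phi h y.
Proof.
by move=> Hh By; rewrite -[k *: h]addr0 (bphi.1 _ _ _ _ Hh sH.1) // bilinear0l // addr0.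
Qed.

Lemma bilinearZr k h y : H h -> B y -> phi h (k *: y) = k *: phi h y.
Proof.
by move=> Hh By; rewrite -[k *: y]addr0 (bphi.2 _ _ _ _ Hh By sB.1) bilinear0r // addr0.
Qed.

Lemma bilinear_suml I (r : seq I) (F : I -> A) y : (forall i, H (F i)) -> B y ->
  phi (\sum_(i <- r) F i) y = \sum_(i <- r) phi (F i) y.
Proof.
move=> hF By; elim: r => [|i r ih]; first by rewrite !big_nil bilinear0l.
rewrite !big_cons -ih -[in LHS](scale1r (F i)) bphi.1 ?scale1r //.
exact: subspace_sum.
Qed.

End Bilinear.
End LinHull.

(** * The operators [Psi], [Delta] and [opD]; the order of [opD] *)

Section Operators.
Variable K : numFieldType.
Notation regfun := (regfun K).
Notation SL2 := (SL2 K).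
Notation sl2H := (sl2H K).
Notation sl2E := (sl2E K).
Notation sl2F := (sl2F K).
Notation a := (entry K 0 0).
Notation d := (entry K 1 1).
Notation t := (trfun K).
Notation Delta := (@Delta K).
Notation Psi := (@Psi K).
Notation opD := (@opD K).
Notation lie := (@lie K).

Lemma tr_sl2H : \tr sl2H = 0.
Proof. by rewrite mxtrace2E !mxE /= !mulr1n !mulr0n; ring. Qed.
Lemma tr_sl2E : \tr sl2E = 0. Proof. by rewrite mxtrace2E !mxE addr0. Qed.
Lemma tr_sl2F : \tr sl2F = 0. Proof. by rewrite mxtrace2E !mxE addr0. Qed.
Lemma tr_Psi_dir (g : SL2) : \tr (Psi_dir g) = 0.
Proof. by case: (SL2_invE g) => e00 _ _ e11; rewrite mxtrace2E !mxE e00 e11; ring. Qed.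

Lemma derivation_Psi : derivation Psi.
Proof. by split=> u v; [apply: vfieldD|apply: vfieldM]; apply: tr_Psi_dir. Qed.

Lemma trfunE : t = a + d.
Proof. by apply/regfun_eqP => g; rewrite regfunD /= mxtrace2E. Qed.

Lemma lie_entryE m i j : \tr m = 0 ->
  lie m (entry K i j) = m 0 j *: entry K i 0 + m 1 j *: entry K i 1.
Proof. by move=> h; rewrite lie_entry // sum2E. Qed.

Lemma lieH0 i : lie sl2H (entry K i 0) = entry K i 0.
Proof.
by rewrite (lie_entryE _ _ tr_sl2H) !mxE /= subr0 subr0 scale1r scale0r addr0.
Qed.
Lemma lieH1 i : lie sl2H (entry K i 1) = - entry K i 1.
Proof.
by rewrite (lie_entryE _ _ tr_sl2H) !mxE /= subr0 sub0r scaleN1r scale0r add0r.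
Qed.
Lemma lieE0 i : lie sl2E (entry K i 0) = 0.
Proof. by rewrite (lie_entryE _ _ tr_sl2E) !mxE /= !scale0r addr0. Qed.
Lemma lieE1 i : lie sl2E (entry K i 1) = entry K i 0.
Proof. by rewrite (lie_entryE _ _ tr_sl2E) !mxE /= scale1r scale0r addr0. Qed.
Lemma lieF0 i : lie sl2F (entry K i 0) = entry K i 1.
Proof. by rewrite (lie_entryE _ _ tr_sl2F) !mxE /= scale1r scale0r add0r. Qed.
Lemma lieF1 i : lie sl2F (entry K i 1) = 0.
Proof. by rewrite (lie_entryE _ _ tr_sl2F) !mxE /= !scale0r addr0. Qed.

Definition lie_entries := (lieH0, lieH1, lieE0, lieE1, lieF0, lieF1).

Lemma Psi_entry i j : Psi (entry K i j) = t * entry K i j - 2 * (i == j)%:R.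
Proof.
apply/regfun_eqP => g; rewrite (vfield_entry _ tr_Psi_dir) mulmxBr.
have -> : SL2_val g *m SL2_val (g^-1)%g = 1%:M by apply: mulmxV; apply: SL2_unitmx.
have det : g 0 0 * g 1 1 = 1 + g 0 1 * g 1 0 by rewrite -(det_SL2 g) det2E subrK.
have n2 : (2 : regfun) g = 2 by [].
have nb (e : bool) : (e%:R : regfun) g = e%:R by case: e.
rewrite trfunE regfunB regfunM regfunD regfunM n2 nb !mxE sum2E /=.
by case: (ord2P i) => ->; case: (ord2P j) => -> /=; ring: det.
Qed.

(** The Casimir form on differentials, that is, the polarized principal symbol of [Delta]; by
    [DeltaM] it measures the failure of the Leibniz rule. *)
Definition gam (u v : regfun) : regfun :=
  lie sl2H u * lie sl2H v + 2 * (lie sl2E u * lie sl2F v + lie sl2F u * lie sl2E v).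

Let dH := derivation_lie tr_sl2H.
Let dE := derivation_lie tr_sl2E.
Let dF := derivation_lie tr_sl2F.

Lemma gamMl u v w : gam (u * v) w = u * gam v w + gam u w * v.
Proof. by rewrite /gam dH.2 dE.2 dF.2; ring. Qed.

Lemma gamMr u v w : gam u (v * w) = v * gam u w + gam u v * w.
Proof. by rewrite /gam dH.2 dE.2 dF.2; ring. Qed.

Lemma DeltaD u v : Delta (u + v) = Delta u + Delta v.
Proof. by rewrite /Delta !(dH.1, dE.1, dF.1); ring. Qed.

Lemma DeltaM u v : Delta (u * v) = Delta u * v + u * Delta v + 2 * gam u v.
Proof.
rewrite /Delta /gam !(dH.2, dE.2, dF.2) !(dH.1, dE.1, dF.1) !(dH.2, dE.2, dF.2).
by ring.
Qed.

(** [Psi] is the gradient of the trace for the Casimir form. Both sides are derivations in [u], so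
    they are compared on the entries, where det g = 1 enters. *)
Lemma gam_trl u : gam u t = Psi u.
Proof.
move: u; apply: (@derivation_comp_ext _ id (gam^~ t)) => // [f h|f h|x f|x f|f h|f h|i j].
- by rewrite /gam dH.1 dE.1 dF.1; ring.
- exact: derivation_Psi.1.
- rewrite /gam /lie !vfieldZ ?(tr_sl2H, tr_sl2E, tr_sl2F) //.
  by rewrite -!scalerAl -scalerDr -scalerAr -scalerDr.
- by apply: vfieldZ; apply: tr_Psi_dir.
- by rewrite gamMl addrC.
- exact: derivation_Psi.2.
- rewrite Psi_entry trfunE /gam !(dH.1, dE.1, dF.1) !lie_entries.
  have det := entry_det K.
  by case: (ord2P i) => ->; case: (ord2P j) => ->; rewrite !lie_entries /=; ring: det.
Qed.

Lemma Delta_tr : Delta t = 3 * t.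
Proof.
rewrite trfunE /Delta !(dH.1, dE.1, dF.1) !lie_entries (derivationN _ dH).
rewrite ?(derivation0 dE) ?(derivation0 dF) !lie_entries; ring.
Qed.

Lemma Psi_tr : Psi t = t ^+ 2 - 4.
Proof. by rewrite {1}trfunE derivation_Psi.1 !Psi_entry trfunE /=; ring. Qed.

Lemma PsiZ x u : Psi (x *: u) = x *: Psi u.
Proof. by apply: vfieldZ; apply: tr_Psi_dir. Qed.

Lemma DeltaZ x u : Delta (x *: u) = x *: Delta u.
Proof.
rewrite /Delta /lie !(vfieldZ, tr_sl2H, tr_sl2E, tr_sl2F) //.
by rewrite -scalerDr -scalerAr -scalerDr.
Qed.

(** The second-order cross term of [opD], a derivation in each argument. *)
Definition gamD (u v : regfun) := - t ^+ 3 * (2 * gam u v) + t * (2 * (Psi u * Psi v)).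

Lemma opDM u v : opD (u * v) = opD u * v + u * opD v + gamD u v.
Proof.
have [PD PM] := derivation_Psi.
by rewrite /opD /gamD DeltaM !(PM, PD); ring.
Qed.

Lemma opD_linear : linear opD.
Proof.
have [PD _] := derivation_Psi.
move=> x u v; rewrite /opD DeltaD DeltaZ !(PD, PsiZ).
move: (Delta u) (Delta v) => Du Dv; rewrite !mulrDr -!scalerAr !scalerDr.
by rewrite [RHS]addrACA; congr (_ + _); rewrite [RHS]addrACA.
Qed.

Lemma opD_diff_op : diff_op opD.
Proof.
split; first exact: opD_linear.
(* The commutator with [x] is multiplication by [opD x] plus the derivation [gamD x]; commuting with
   [y] leaves multiplication by [gamD x y], and the third commutator is zero. *)
exists 3%N => x y z f; rewrite !opDM /gamD !gamMr !derivation_Psi.2; ring.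
Qed.

End Operators.

(** * Invariance of the operators under conjugation *)

Section Conjugation.
Variable K : numFieldType.
Notation SL2 := (SL2 K).
Notation sl2H := (sl2H K).
Notation sl2E := (sl2E K).
Notation sl2F := (sl2F K).
Notation a := (entry K 0 0).
Notation b := (entry K 0 1).
Notation c := (entry K 1 0).
Notation d := (entry K 1 1).
Notation t := (trfun K).
Notation Delta := (@Delta K).
Notation Psi := (@Psi K).
Notation opD := (@opD K).
Notation lie := (@lie K).
Notation conj_act := (@conj_act K).

Lemma conj_actD x : {morph conj_act x : f h / f + h}.
Proof. by move=> f h; apply/regfun_eqP. Qed.
Lemma conj_actM x : {morph conj_act x : f h / f * h}.
Proof. by move=> f h; apply/regfun_eqP. Qed.
Lemma conj_act1 x : conj_act x 1 = 1.
Proof. exact/regfun_eqP. Qed.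
Lemma conj_act0 x : conj_act x 0 = 0.
Proof. exact/regfun_eqP. Qed.
Lemma conj_actZ x k f : conj_act x (k *: f) = k *: conj_act x f.
Proof. exact/regfun_eqP. Qed.
Lemma conj_actN x f : conj_act x (- f) = - conj_act x f.
Proof. exact/regfun_eqP. Qed.

Lemma conj_actX x f n : conj_act x (f ^+ n) = conj_act x f ^+ n.
Proof. by elim: n => [|n ih]; rewrite ?conj_act1 // !exprS conj_actM ih. Qed.

Lemma conj_act_tr x : conj_act x t = t.
Proof.
apply/regfun_eqP => g; have -> : conj_act x t g = \tr (invmx x *m (SL2_val g *m x)) by [].
by rewrite mxtrace_mulC -mulmxA mulmxV ?SL2_unitmx // mulmx1.
Qed.

Lemma conj_act_entry (x : SL2) i j (y := invmx x : 'M[K]_2) : conj_act x (entry K i j) =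
  (y i 0 * x 0 j) *: a + (y i 0 * x 1 j) *: b + (y i 1 * x 0 j) *: c + (y i 1 * x 1 j) *: d.
Proof.
apply/regfun_eqP => g; rewrite !(regfunD, regfunZ).
have -> : conj_act x (entry K i j) g = (y *m (SL2_val g *m x)) i j by [].
by rewrite !mxE !sum2E !mxE !sum2E /=; ring.
Qed.

(** The last hypothesis says that conjugation by [x] carries one field to the other. Both sides are
    derivations along [conj_act x], so only the entries have to be checked. *)
Lemma vfield_conj_act (X Y : SL2 -> 'M[K]_2) (hX : regular_map X) (hY : regular_map Y) (x : SL2) :
    (forall g, \tr (X g) = 0) -> (forall g, \tr (Y g) = 0) ->
    (forall g : SL2, (x : 'M_2) *m Y (g ^ x)%g = X g *m x) ->
  forall f, vfield hX (conj_act x f) = conj_act x (vfield hY f).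
Proof.
move=> trX trY XY.
apply: (@derivation_comp_ext _ (conj_act x)) => [||f h|f h|k f|k f|f h|f h|i j].
- exact: conj_actM.
- exact: conj_act1.
- by rewrite conj_actD vfieldD.
- by rewrite vfieldD // conj_actD.
- by rewrite conj_actZ vfieldZ.
- by rewrite vfieldZ // conj_actZ.
- by rewrite conj_actM vfieldM.
- by rewrite vfieldM // conj_actD !conj_actM.
rewrite conj_act_entry !(vfieldD, vfieldZ) //.
apply/regfun_eqP => g; rewrite !(regfunD, regfunZ) !vfield_entry //.
have -> : conj_act x (vfield hY (entry K i j)) g = vfield hY (entry K i j) (g ^ x)%g by [].
rewrite vfield_entry //.
have -> : SL2_val (g ^ x)%g *m Y (g ^ x)%g = invmx x *m ((SL2_val g *m X g) *m x).
  rewrite -mulmxA -XY !mulmxA; congr (_ *m _).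
  by have -> : SL2_val (g ^ x)%g = invmx x *m (SL2_val g *m x) by []; rewrite mulmxA.
by rewrite [RHS]mxE sum2E ![(_ *m (x : 'M_2)) _ _]mxE !sum2E; ring.
Qed.

Lemma Psi_conj_act x f : Psi (conj_act x f) = conj_act x (Psi f).
Proof.
apply: vfield_conj_act => [g|g|g]; try exact: tr_Psi_dir.
rewrite /Psi_dir mulmxBr mulmxBl.
have -> : ((g ^ x)^-1 = (g^-1) ^ x)%g by rewrite conjVg.
have e h : SL2_val (h ^ x)%g = invmx x *m (SL2_val h *m x) by [].
by rewrite !e !mulmxA mulmxV ?SL2_unitmx // !mul1mx.
Qed.

Lemma lie_conj_act (x : SL2) m f : \tr m = 0 ->
  lie m (conj_act x f) = conj_act x (lie (invmx x *m m *m x) f).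
Proof.
move=> trm; apply: vfield_conj_act => // g.
  by rewrite mxtrace_mulC mulmxA mulmxV ?SL2_unitmx // mul1mx.
by rewrite !mulmxA mulmxV ?SL2_unitmx // mul1mx.
Qed.

Lemma lie_linear k m n f : lie (k *: m + n) f = k *: lie m f + lie n f.
Proof.
apply/regfun_eqP => g.
have e m' : lie m' f g = dder (extension f) g (SL2_val g *m m') by [].
by rewrite regfunD regfunZ !e mulmxDr -scalemxAr dder_linear.
Qed.

Lemma lie0 f : lie 0 f = 0.
Proof.
have := lie_linear 1 0 0 f; rewrite scale1r addr0 scale1r => h.
by apply: (@addIr _ (lie 0 f)); rewrite add0r -h.
Qed.

(** The Casimir element is fixed by the adjoint action. The proof expands the conjugates of H, E, F
    in the basis H, E, F and compares coefficients. *)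
Lemma Delta_conj_act x f : Delta (conj_act x f) = conj_act x (Delta f).
Proof.
have trs := (tr_sl2H K, tr_sl2E K, tr_sl2F K).
have [y00 y01 y10 y11] := SL2_invE x.
have det : x 0 0 * x 1 1 = 1 + x 0 1 * x 1 0 by rewrite -(det_SL2 x) det2E subrK.
rewrite /Delta; do !rewrite lie_conj_act ?trs //.
rewrite -!(conj_actD, conj_actM).
have e2 : conj_act x 2 = 2 by apply/regfun_eqP.
rewrite -{1}e2 -!(conj_actD, conj_actM); congr (conj_act x _).
have dec m : \tr m = 0 -> m = m 0 0 *: sl2H + (m 0 1 *: sl2E + m 1 0 *: sl2F).
  move=> h; have h11 : m 1 1 = - m 0 0.
    by apply/eqP; rewrite -addr_eq0 addrC -mxtrace2E h.
  by apply: mx2P; rewrite !mxE /= ?h11 ?mulr1n ?mulr0n; ring.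
have decl m h : \tr m = 0 ->
    lie m h = m 0 0 *: lie sl2H h + (m 0 1 *: lie sl2E h + m 1 0 *: lie sl2F h).
  move=> /dec {1}->; rewrite !lie_linear; congr (_ + (_ + _)).
  by rewrite -[_ *: sl2F]addr0 lie_linear lie0 addr0.
have trc m : \tr m = 0 -> \tr (invmx x *m m *m x) = 0.
  by move=> h; rewrite mxtrace_mulC mulmxA mulmxV ?SL2_unitmx // mul1mx.
have lieL m k u v : \tr m = 0 -> lie m (k *: u + v) = k *: lie m u + lie m v.
  by move=> h; rewrite /lie vfieldD ?vfieldZ.
have lieZ m k u : \tr m = 0 -> lie m (k *: u) = k *: lie m u.
  by move=> h; rewrite /lie vfieldZ.
pose cj m := invmx x *m m *m (x : 'M_2).
rewrite -!/(cj _).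
have decH h := decl (cj sl2H) h (trc _ trs.1.1).
have decE h := decl (cj sl2E) h (trc _ trs.1.2).
have decF h := decl (cj sl2F) h (trc _ trs.2).
rewrite !(decH, decE, decF).
rewrite !(lieL, lieZ, trs) //.
have cjE m i j : cj m i j = (x^-1)%g i 0 * (m 0 0 * x 0 j + m 0 1 * x 1 j) +
    (x^-1)%g i 1 * (m 1 0 * x 0 j + m 1 1 * x 1 j).
  rewrite /cj (_ : invmx x = (x^-1)%g) // !mxE !sum2E !mxE !sum2E; ring.
(* The coordinates of the conjugated basis are quadratic in the entries of [x]. *)
have [cH00 cH01 cH10] : [/\ cj sl2H 0 0 = x 0 0 * x 1 1 + x 0 1 * x 1 0,
    cj sl2H 0 1 = 2 * (x 0 1 * x 1 1) & cj sl2H 1 0 = - 2 * (x 0 0 * x 1 0)].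
  by split; rewrite cjE ?(y00, y01, y10, y11) !mxE /= ?mulr1n ?mulr0n; ring.
have [cE00 cE01 cE10] : [/\ cj sl2E 0 0 = x 1 1 * x 1 0,
    cj sl2E 0 1 = x 1 1 ^+ 2 & cj sl2E 1 0 = - x 1 0 ^+ 2].
  by split; rewrite cjE ?(y00, y01, y10, y11) !mxE /= ?mulr1n ?mulr0n; ring.
have [cF00 cF01 cF10] : [/\ cj sl2F 0 0 = - (x 0 1 * x 0 0),
    cj sl2F 0 1 = - x 0 1 ^+ 2 & cj sl2F 1 0 = x 0 0 ^+ 2].
  by split; rewrite cjE ?(y00, y01, y10, y11) !mxE /= ?mulr1n ?mulr0n; ring.
rewrite cH00 cH01 cH10 cE00 cE01 cE10 cF00 cF01 cF10.
(* Once the nine second derivatives of [f] are free variables, a polynomial identity modulo [det]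
   remains. *)
move: (lie sl2H (lie sl2H f)) (lie sl2H (lie sl2E f)) (lie sl2H (lie sl2F f))
  (lie sl2E (lie sl2H f)) (lie sl2E (lie sl2E f)) (lie sl2E (lie sl2F f))
  (lie sl2F (lie sl2H f)) (lie sl2F (lie sl2E f)) (lie sl2F (lie sl2F f)).
move=> HH HE HF EH EE EF FH FE FF {e2 decH decE decF}.
apply/regfun_eqP => g; rewrite !(regfunZ, regfunD, regfunM) ?regfun1.
by ring: det.
Qed.

Lemma opD_conj_act : invariant_op conj_act opD.
Proof.
move=> x f; rewrite /opD !Psi_conj_act Delta_conj_act !(conj_actD, conj_actM).
by rewrite conj_actN !conj_actX conj_act_tr !conj_act1.
Qed.

End Conjugation.

(** * Action of [opD] on products of harmonic functions and polynomials in the trace *)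

Section HarmonicFunctions.
Variable K : numFieldType.
Notation regfun := (regfun K).
Notation sl2H := (sl2H K).
Notation sl2E := (sl2E K).
Notation sl2F := (sl2F K).
Notation a := (entry K 0 0).
Notation b := (entry K 0 1).
Notation c := (entry K 1 0).
Notation d := (entry K 1 1).
Notation t := (trfun K).
Notation Delta := (@Delta K).
Notation Psi := (@Psi K).
Notation opD := (@opD K).
Notation lie := (@lie K).

Definition trpoly (p : {poly K}) : regfun := horner_alg t p.

Lemma trpolyE p g : trpoly p g = p.[\tr (SL2_val g)].
Proof.
rewrite /trpoly; elim/poly_ind: p => [|p k ih]; first by rewrite rmorph0 horner0.
rewrite rmorphD rmorphM /= horner_algX horner_algC !hornerE -ih.
by rewrite -[k in RHS]mulr1.
Qed.

Lemma trpolyD p q : trpoly (p + q) = trpoly p + trpoly q.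
Proof. by rewrite /trpoly rmorphD. Qed.
Lemma trpolyM p q : trpoly (p * q) = trpoly p * trpoly q.
Proof. by rewrite /trpoly rmorphM. Qed.
Lemma trpolyB p q : trpoly (p - q) = trpoly p - trpoly q.
Proof. by rewrite /trpoly rmorphB. Qed.
Lemma trpolyN p : trpoly (- p) = - trpoly p.
Proof. by rewrite /trpoly rmorphN. Qed.
Lemma trpolyX : trpoly 'X = t.
Proof. by rewrite /trpoly horner_algX. Qed.
Lemma trpolyC k : trpoly k%:P = k *: 1.
Proof. by rewrite /trpoly horner_algC. Qed.
Lemma trpoly0 : trpoly 0 = 0.
Proof. by rewrite /trpoly rmorph0. Qed.
Lemma trpoly1 : trpoly 1 = 1.
Proof. by rewrite /trpoly rmorph1. Qed.
Lemma trpolyZ k p : trpoly (k *: p) = k *: trpoly p.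
Proof. by rewrite -mul_polyC trpolyM trpolyC -scalerAl mul1r. Qed.

Lemma trpoly_derivation (D : regfun -> regfun) :
    derivation D -> (forall k f, D (k *: f) = k *: D f) ->
  forall p, D (trpoly p) = trpoly p^`() * D t.
Proof.
move=> hD hZ; elim/poly_ind => [|p k ih].
  by rewrite deriv0 trpoly0 mul0r (derivation0 hD).
rewrite trpolyD trpolyM trpolyX trpolyC hD.1 hD.2 hZ (derivation1 hD) scaler0 addr0.
by rewrite derivD derivC addr0 derivM derivX trpolyD !trpolyM trpolyX trpoly1 ih; ring.
Qed.

Lemma Psi_trpoly p : Psi (trpoly p) = trpoly p^`() * (t ^+ 2 - 4).
Proof. by rewrite (trpoly_derivation (derivation_Psi K) (@PsiZ K)) Psi_tr. Qed.

Lemma lie_trpoly m p : \tr m = 0 -> lie m (trpoly p) = trpoly p^`() * lie m t.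
Proof.
by move=> h; apply: trpoly_derivation => [|k f]; [apply: derivation_lie|apply: vfieldZ].
Qed.

Lemma gam_trpoly u p : gam u (trpoly p) = trpoly p^`() * Psi u.
Proof. by rewrite -gam_trl /gam !lie_trpoly ?(tr_sl2H, tr_sl2E, tr_sl2F) //; ring. Qed.

(** Second-order chain rule, with [gam t t = Psi t = t ^+ 2 - 4] as the coefficient of the second
    derivative. *)
Lemma Delta_trpoly p :
  Delta (trpoly p) = 3 * t * trpoly p^`() + (t ^+ 2 - 4) * trpoly p^`()^`().
Proof.
have trs := (tr_sl2H K, tr_sl2E K, tr_sl2F K).
have [[dH dE] dF] := (derivation_lie trs.1.1, derivation_lie trs.1.2, derivation_lie trs.2).
have -> : Delta (trpoly p) = trpoly p^`() * Delta t + trpoly p^`()^`() * gam t t.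
  rewrite /Delta /gam !lie_trpoly ?trs // !(dH.2, dE.2, dF.2).
  by rewrite !lie_trpoly ?trs //; ring.
by rewrite Delta_tr gam_trl Psi_tr; ring.
Qed.

Definition quadpoly (B : comNzRingType) (u v w : B) : {poly B} :=
  u%:P * 'X^2 + v%:P * 'X + w%:P.

Lemma map_quadpoly (B B' : comNzRingType) (D : B -> B') u v w : D 0 = 0 ->
  map_poly D (quadpoly u v w) = quadpoly (D u) (D v) (D w).
Proof.
move=> D0; apply/polyP => i; rewrite coef_map_id0 // !coefD !coefCM !coefC !coefXn !coefX.
by case: i => [|[|[|i]]] //=; rewrite ?(mulr0, mulr1, addr0, add0r).
Qed.

Lemma quadpolyZ (B : comNzRingType) (k u v w : B) :
  quadpoly (k * u) (k * v) (k * w) = k%:P * quadpoly u v w.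
Proof. by rewrite /quadpoly !polyCM; ring. Qed.

(* For v = (1, s), the function g |-> det (g v, v), as a polynomial in s; its
   powers generate the harmonic polynomials on sl2. *)
Definition ell : {poly regfun} := quadpoly b (a - d) (- c).

Definition harm n k : regfun := (ell ^+ n)`_k.

(** The constants in [Psi_entry] cancel in [b], [a - d] and [c], so [Psi], applied coefficientwise,
    multiplies [ell] by [t]; the power rule gives the factor n. *)
Lemma Psi_harm n k : Psi (harm n k) = n%:R * (t * harm n k).
Proof.
have dP := derivation_poly (derivation_Psi K).
have -> : Psi (harm n k) = (map_poly Psi (ell ^+ n))`_k.
  by rewrite coef_map_id0 // (derivation0 (derivation_Psi K)).
have ePsi : map_poly Psi ell = t%:P * ell.
  rewrite map_quadpoly ?(derivation0 (derivation_Psi K)) //.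
  rewrite (derivation_Psi K).1 !(derivationN _ (derivation_Psi K)) !Psi_entry /= -quadpolyZ.
  by apply: (f_equal3 (@quadpoly _)); ring.
case: n => [|n]; first by rewrite expr0 (derivation1 dP) coef0 mul0r.
rewrite (derivationX _ _ dP) ePsi.
have -> : n.+1%:R * ell ^+ n * (t%:P * ell) = (t%:P * ell ^+ n.+1) *+ n.+1.
  by rewrite -mulr_natl exprS; ring.
by rewrite coefMn coefCM mulr_natl.
Qed.

(** The second-order part contributes n (n - 1) by the hypothesis on first derivatives, the
    first-order part 3 n; their sum is n (n + 2). *)
Lemma casimir_pow (B : comNzRingType) (H E F : B -> B) u n :
    derivation H -> derivation E -> derivation F ->
    H (H u) + 2 * (E (F u) + F (E u)) = 3 * u ->
    H u * H u + 4 * (E u * F u) = u ^+ 2 ->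
  H (H (u ^+ n)) + 2 * (E (F (u ^+ n)) + F (E (u ^+ n))) = (n * (n + 2))%:R * u ^+ n.
Proof.
move=> dH dE dF e1 e2; case: n => [|n].
  rewrite expr0 ?(derivation1 dH) ?(derivation1 dE) ?(derivation1 dF).
  by rewrite ?(derivation0 dH) ?(derivation0 dE) ?(derivation0 dF) !mul0r; ring.
have D2 (D D' : B -> B) : derivation D -> derivation D' ->
    D (D' (u ^+ n.+1)) = n.+1%:R * (n%:R * u ^+ n.-1 * (D u * D' u) + u ^+ n * D (D' u)).
  move=> dD dD'; rewrite (derivationX _ _ dD') dD.2 dD.2 (derivation_nat _ dD).
  case: n => [|n]; first by rewrite expr0 (derivation1 dD); ring.
  by rewrite (derivationX _ _ dD); ring.
rewrite (D2 _ _ dH dH) (D2 _ _ dE dF) (D2 _ _ dF dE).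
transitivity (n.+1%:R * (n%:R * u ^+ n.-1 * (H u * H u + 4 * (E u * F u)) +
   u ^+ n * (H (H u) + 2 * (E (F u) + F (E u))))); first by ring.
rewrite e1 e2 natrM natrD !exprS.
by case: n {D2} => [|n] /=; rewrite ?exprS; ring.
Qed.

Lemma Delta_harm n k : Delta (harm n k) = (n * (n + 2))%:R * harm n k.
Proof.
have trs := (tr_sl2H K, tr_sl2E K, tr_sl2F K).
have [[dH dE] dF] := (derivation_lie trs.1.1, derivation_lie trs.1.2, derivation_lie trs.2).
pose D m := map_poly (lie m).
have cD m p i : \tr m = 0 -> (D m p)`_i = lie m p`_i.
  by move=> h; rewrite coef_map_id0 // (derivation0 (derivation_lie h)).
have qD m u v w : \tr m = 0 -> D m (quadpoly u v w) = quadpoly (lie m u) (lie m v) (lie m w).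
  by move=> h; rewrite /D map_quadpoly // (derivation0 (derivation_lie h)).
have -> : Delta (harm n k) = (D sl2H (D sl2H (ell ^+ n)) +
    2 * (D sl2E (D sl2F (ell ^+ n)) + D sl2F (D sl2E (ell ^+ n))))`_k.
  by rewrite coefD mulr_natl coefMn coefD !cD ?trs // -mulr_natl.
rewrite casimir_pow; try exact: derivation_poly.
- by rewrite !mulr_natl coefMn.
- rewrite /ell !qD ?trs // !(dH.1, dE.1, dF.1).
  rewrite ?(derivationN _ dH) ?(derivationN _ dE) ?(derivationN _ dF).
  rewrite !lie_entries ?(derivationN _ dH) ?(derivationN _ dE) ?(derivationN _ dF) !lie_entries.
  rewrite ?(derivation0 dH) ?(derivation0 dE) ?(derivation0 dF).
  by rewrite /quadpoly; ring.
(* The quadratic identity for the first derivatives of [ell] uses det g = 1. *)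
- rewrite /ell !qD ?trs // !(dH.1, dE.1, dF.1).
  rewrite ?(derivationN _ dH) ?(derivationN _ dE) ?(derivationN _ dF).
  rewrite !lie_entries.
  have det : a%:P * d%:P = 1 + b%:P * c%:P by rewrite -!polyCM entry_det polyCD.
  by rewrite /quadpoly !(polyCN, polyCD) !polyC0; ring: det.
Qed.

(* The radial part of opD on the isotypic component of harm n. *)
Definition radial n (p : {poly K}) : {poly K} :=
  - 4 * 'X * ('X^2 - 4) * p^`()^`() - (8 * n.+1%:R * 'X^2 + 16) * p^`().

(** The terms without a derivative of [p] cancel: [Psi] applied twice to [harm n k] gives the factor
    n (t^2 - 4) + n^2 t^2, and - n (n + 2) t^3 + t (n (t^2 - 4) + n^2 t^2) + (t^2 + 4) n t = 0. The
    t^4 terms in front of p' cancel as well. *)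
Lemma opD_harm_trpoly n k p : opD (harm n k * trpoly p) = harm n k * trpoly (radial n p).
Proof.
have [PD PM] := derivation_Psi K.
have Pn m u : Psi (m%:R * u) = m%:R * Psi u.
  by rewrite PM (derivation_nat _ (derivation_Psi K)) mul0r add0r.
have PN u : Psi (- u) = - Psi u := derivationN _ (derivation_Psi K).
rewrite /opD DeltaM gam_trpoly Delta_harm Delta_trpoly.
rewrite !(PM, PD, Psi_trpoly, Psi_harm, Pn, PN, Psi_tr, expr2).
rewrite /radial !(trpolyB, trpolyM, trpolyD, trpolyX).
have tn m : trpoly m%:R = m%:R by rewrite /trpoly rmorph_nat.
rewrite !(trpolyN, tn, trpolyM, trpolyX, natrM, natrD) -[n.+1]addn1 natrD.
rewrite !trpoly1 (derivation1 (derivation_Psi K)).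
ring.
Qed.

End HarmonicFunctions.

(** * The functions [harm n k] span C[G] over C[t] *)

Section Expansion.
Variable K : numFieldType.
Notation regfun := (regfun K).
Notation a := (entry K 0 0).
Notation b := (entry K 0 1).
Notation c := (entry K 1 0).
Notation d := (entry K 1 1).
Notation t := (trfun K).
Notation harm := (@harm K).
Notation ell := (@ell K).
Notation trpoly := (@trpoly K).
Implicit Types (q : nat -> nat -> {poly K}).

Definition expansion N q : regfun :=
  \sum_(n < N) \sum_(k < (2 * n).+1) harm n k * trpoly (q n k).

Lemma eq_expansion N q q' :
    (forall n k, (n < N)%N -> (k < (2 * n).+1)%N -> q n k = q' n k) ->
  expansion N q = expansion N q'.
Proof. by move=> h; apply: eq_bigr => n _; apply: eq_bigr => k _; rewrite h. Qed.

Lemma expansionD N q q' :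
  expansion N (fun n k => q n k + q' n k) = expansion N q + expansion N q'.
Proof.
rewrite /expansion -big_split; apply: eq_bigr => n _.
by rewrite -big_split; apply: eq_bigr => k _; rewrite trpolyD mulrDr.
Qed.

Lemma expansionM N p q : expansion N (fun n k => p * q n k) = trpoly p * expansion N q.
Proof.
rewrite mulr_sumr; apply: eq_bigr => n _; rewrite mulr_sumr.
by apply: eq_bigr => k _; rewrite trpolyM mulrCA.
Qed.

Lemma expansionB N q q' :
  expansion N (fun n k => q n k - q' n k) = expansion N q - expansion N q'.
Proof.
rewrite -[- _]mulN1r (_ : -1 = trpoly (-1)); last by rewrite /trpoly rmorphN1.
by rewrite -expansionM -expansionD; apply: eq_expansion => n k _ _; rewrite mulN1r.
Qed.

(** One family [q] serves for every large enough bound, so that two expansions can be brought to a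
    common length. *)
Definition spanned (f : regfun) :=
  exists N q, forall N', (N <= N')%N -> f = expansion N' q.

Lemma spannedD f h : spanned f -> spanned h -> spanned (f + h).
Proof.
move=> [N [q e]] [N' [q' e']]; exists (maxn N N'), (fun n k => q n k + q' n k) => M.
by rewrite geq_max => /andP[NM NM']; rewrite expansionD -e // -e'.
Qed.

Lemma spannedM p f : spanned f -> spanned (trpoly p * f).
Proof.
by move=> [N [q e]]; exists N, (fun n k => p * q n k) => M NM; rewrite expansionM -e.
Qed.

Lemma spannedZ k f : spanned f -> spanned (k *: f).
Proof. by rewrite -[f in _ *: f]mul1r scalerAl -trpolyC; apply: spannedM. Qed.

Lemma spanned0 : spanned 0.
Proof.
exists 0%N, (fun _ _ => 0) => N _; rewrite /expansion big1 // => n _.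
by rewrite big1 // => k _; rewrite trpoly0 mulr0.
Qed.

Lemma spanned_sum I (r : seq I) (P : pred I) (F : I -> regfun) :
  (forall i, P i -> spanned (F i)) -> spanned (\sum_(i <- r | P i) F i).
Proof. by move=> h; apply: big_ind => //; [exact: spanned0|exact: spannedD]. Qed.

Lemma spannedMn m f : spanned f -> spanned (m%:R * f).
Proof. by rewrite mulr_natl -scaler_nat; apply: spannedZ. Qed.

Lemma spanned_natP m f : (0 < m)%N -> spanned (m%:R * f) -> spanned f.
Proof.
move=> m0 /(spannedZ (m%:R^-1)).
by rewrite mulr_natl -scaler_nat scalerA mulVf ?scale1r // pnatr_eq0 -lt0n.
Qed.

Lemma harm_big n k : ((2 * n).+1 <= k)%N -> harm n k = 0.
Proof.
move=> nk; apply: nth_default; apply: leq_trans (size_poly_exp_leq _ _) _.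
apply: leq_trans nk; rewrite ltnS leq_mul2r; apply/orP; right.
have s : (size ell <= 3)%N.
  apply/leq_sizeP => -[|[|[|j]]] // _.
  by rewrite !coefD !coefCM coefC coefXn coefX /= !mulr0 !addr0.
by move: s; case: (size _).
Qed.

Lemma spanned_harm n k : spanned (harm n k).
Proof.
case: (ltnP k (2 * n).+1) => [kn|/harm_big->]; last exact: spanned0.
exists n.+1, (fun n' k' => ((n' == n) && (k' == k))%:R) => N nN.
rewrite /expansion (bigD1 (Ordinal nN)) //= (bigD1 (Ordinal kn)) //= !eqxx trpoly1 mulr1.
rewrite big1 ?addr0 => [|i ik]; last first.
  rewrite (_ : (i == k :> nat) = false) ?trpoly0 ?mulr0 //; exact: negPf ik.
rewrite big1 ?addr0 // => i ni; rewrite big1 // => j _.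
rewrite (_ : (i == n :> nat) = false) ?trpoly0 ?mulr0 //; exact: negPf ni.
Qed.

Lemma deriv_derivation (B : comNzRingType) : derivation (@deriv B).
Proof. by split=> u v; [apply: derivD|rewrite derivM addrC; congr (_ + _); rewrite mulrC]. Qed.

Lemma deriv_ell : ell^`() = (2 * b)%:P * 'X + (a - d)%:P.
Proof. by rewrite /ell /quadpoly !derivE polyCM; ring. Qed.

(* The discriminant of ell, i.e. minus four times the determinant of the
   traceless part of g. *)
Lemma deriv_ell_sqr : ell^`() ^+ 2 = 4 * b%:P * ell + (t ^+ 2 - 4)%:P.
Proof.
rewrite deriv_ell trfunE /ell /quadpoly.
have det : a%:P * d%:P = 1 + b%:P * c%:P by rewrite -!polyCM entry_det polyCD.
rewrite expr2 !(polyCN, polyCD, polyCM); ring: det.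
Qed.

(** In the second derivative of [ell ^+ n.+1], the second derivative of [ell] is 2 b and its squared
    first derivative is 4 b [ell] plus the discriminant. The coefficients of b [ell ^+ n] add up to
    (n + 1) (4 n + 2). *)
Lemma mul_b_ell n : (2 * n.+1 * (2 * n).+1)%:R * (b%:P * ell ^+ n) =
  (ell ^+ n.+1)^`()^`() - (n * n.+1)%:R * ((t ^+ 2 - 4)%:P * ell ^+ n.-1).
Proof.
have dX := deriv_derivation regfun.
have -> : (ell ^+ n.+1)^`()^`() =
    n.+1%:R * (n%:R * ell ^+ n.-1 * ell^`() ^+ 2 + ell ^+ n * ell^`()^`()).
  rewrite (derivationX _ _ dX) dX.2 dX.2 (derivation_nat _ dX).
  case: n => [|n]; first by rewrite expr0 (derivation1 dX); ring.
  by rewrite (derivationX _ _ dX); ring.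
have -> : ell^`()^`() = 2 * b%:P by rewrite deriv_ell !derivE; ring.
rewrite deriv_ell_sqr -[n.+1]addn1 -[(2 * n).+1]addn1 !(natrM, natrD).
(* For n = 0 the truncated exponent [n.-1] is harmless, since its term has the factor n. *)
by case: n => [|n] /=; rewrite ?exprS; ring.
Qed.

(** Treating all coefficients in s at once makes differentiation in s and multiplication by s
    available. *)
Definition coef_spanned (u : {poly regfun}) := forall k, spanned u`_k.

Lemma coef_spannedD u v : coef_spanned u -> coef_spanned v -> coef_spanned (u + v).
Proof. by move=> hu hv k; rewrite coefD; apply: spannedD. Qed.

Lemma coef_spanned_trpolyM p u : coef_spanned u -> coef_spanned ((trpoly p)%:P * u).
Proof. by move=> hu k; rewrite coefCM; apply: spannedM. Qed.

Lemma coef_spannedMn m u : coef_spanned u -> coef_spanned (m%:R * u).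
Proof. by move=> hu k; rewrite mulr_natl coefMn -mulr_natl; apply: spannedMn. Qed.

Lemma coef_spannedN u : coef_spanned u -> coef_spanned (- u).
Proof.
move=> hu; rewrite -mulN1r (_ : -1 = (trpoly (-1))%:P); first exact: coef_spanned_trpolyM.
by rewrite trpolyN trpoly1 polyCN.
Qed.

Lemma coef_spannedX u : coef_spanned u -> coef_spanned (u * 'X).
Proof. by move=> hu k; rewrite coefMX; case: eqP => _; [exact: spanned0|]. Qed.

Lemma coef_spanned_deriv u : coef_spanned u -> coef_spanned u^`().
Proof. by move=> hu k; rewrite coef_deriv -mulr_natl; apply: spannedMn. Qed.

Lemma coef_spanned_natP m u : (0 < m)%N -> coef_spanned (m%:R * u) -> coef_spanned u.
Proof.
by move=> m0 hu k; apply: (spanned_natP m0); have := hu k; rewrite !mulr_natl coefMn.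
Qed.

Lemma coef_spanned_b n : coef_spanned (b%:P * ell ^+ n).
Proof.
apply: (@coef_spanned_natP (2 * n.+1 * (2 * n).+1)) => //; rewrite mul_b_ell.
have -> : (t ^+ 2 - 4) = trpoly ('X^2 - 4).
  by rewrite trpolyB /trpoly rmorphXn /= horner_algX rmorph_nat.
have hl m : coef_spanned (ell ^+ m) by move=> k; apply: spanned_harm.
apply: coef_spannedD; first by do 2!apply: coef_spanned_deriv.
by apply/coef_spannedN/coef_spannedMn/coef_spanned_trpolyM.
Qed.

(** The first derivative of [ell ^+ n.+1] is (n + 1) (2 b s + a - d) [ell ^+ n], whose b-part is
    already spanned. *)
Lemma coef_spanned_ad n : coef_spanned ((a - d)%:P * ell ^+ n).
Proof.
apply: (@coef_spanned_natP n.+1) => //.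
have -> : n.+1%:R * ((a - d)%:P * ell ^+ n) =
    (ell ^+ n.+1)^`() - (2 * n.+1)%:R * (b%:P * ell ^+ n * 'X).
  rewrite (derivationX _ _ (deriv_derivation _)) deriv_ell polyCM natrM; ring.
apply: coef_spannedD; first by apply: coef_spanned_deriv => k; apply: spanned_harm.
by apply/coef_spannedN/coef_spannedMn/coef_spannedX/coef_spanned_b.
Qed.

(** Solve [ell ^+ n.+1] = (b s^2 + (a - d) s - c) [ell ^+ n] for the last term. *)
Lemma coef_spanned_c n : coef_spanned (c%:P * ell ^+ n).
Proof.
have -> : c%:P * ell ^+ n =
    b%:P * ell ^+ n * 'X * 'X + (a - d)%:P * ell ^+ n * 'X - ell ^+ n.+1.
  by rewrite exprS {4}/ell /quadpoly polyCN; ring.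
apply: coef_spannedD; last by apply: coef_spannedN => k; apply: spanned_harm.
apply: coef_spannedD; first by do 2!apply: coef_spannedX; apply: coef_spanned_b.
by apply/coef_spannedX/coef_spanned_ad.
Qed.

Lemma spannedMl x : (forall n k, spanned (x * harm n k)) ->
  forall f, spanned f -> spanned (x * f).
Proof.
move=> hx f [N [q /(_ N (leqnn N)) ->]]; rewrite /expansion mulr_sumr.
apply: spanned_sum => n _; rewrite mulr_sumr; apply: spanned_sum => k _.
by rewrite mulrA mulrC; apply: spannedM.
Qed.

Lemma spanned_trM f : spanned f -> spanned (t * f).
Proof. by rewrite -trpolyX; apply: spannedM. Qed.

(** The span contains 1 = [harm 0 0] and is stable under b, c, a - d and t, hence under all entries,
    which generate the algebra. *)
Lemma spanned_all f : spanned f.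
Proof.
suff key : forall h, spanned h -> spanned (f * h).
  by rewrite -[f]mulr1 -(_ : harm 0 0 = 1);
    [apply/key/spanned_harm|rewrite /harm expr0 coef1].
elim/regfun_ind: f => [k|i j|f f' hf hf'|f f' hf hf'] h hh.
- by rewrite -scalerAl mul1r; apply: spannedZ.
- have hb : spanned (b * h).
    by apply: spannedMl hh => n k; rewrite -coefCM; apply: coef_spanned_b.
  have hc : spanned (c * h).
    by apply: spannedMl hh => n k; rewrite -coefCM; apply: coef_spanned_c.
  have had : spanned ((a - d) * h).
    by apply: spannedMl hh => n k; rewrite -coefCM; apply: coef_spanned_ad.
  have ht := spanned_trM hh.
  case: (ord2P i) => ->; case: (ord2P j) => -> //.
  + apply: (@spanned_natP 2) => //.
    have -> : 2 * (a * h) = t * h + (a - d) * h by rewrite trfunE; ring.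
    exact: spannedD.
  + apply: (@spanned_natP 2) => //.
    have -> : 2 * (d * h) = t * h + (- 1) *: ((a - d) * h).
      by rewrite scaleN1r trfunE; ring.
    by apply: spannedD => //; apply: spannedZ.
- by rewrite mulrDl; apply: spannedD; [apply: hf|apply: hf'].
- by rewrite -mulrA; apply/hf/hf'.
Qed.

End Expansion.

(** * Uniqueness of expansions and the ring of invariants *)

Section Independence.
Variable K : numFieldType.
Notation regfun := (regfun K).
Notation a := (entry K 0 0).
Notation b := (entry K 0 1).
Notation c := (entry K 1 0).
Notation d := (entry K 1 1).
Notation conj_act := (@conj_act K).
Notation harm := (@harm K).
Notation ell := (@ell K).
Notation trpoly := (@trpoly K).
Notation expansion := (@expansion K).
Implicit Types (q : nat -> nat -> {poly K}).

HB.instance Definition _ x := GRing.isNmodMorphism.Build regfun regfun (conj_act x)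
  (conj_act0 x, conj_actD x).
HB.instance Definition _ x := GRing.isMonoidMorphism.Build regfun regfun (conj_act x)
  (conj_act1 x, conj_actM x).

Lemma conj_act_harm x n k : conj_act x (harm n k) =
  (quadpoly (conj_act x b) (conj_act x (a - d)) (conj_act x (- c)) ^+ n)`_k.
Proof. by rewrite /harm -coef_map rmorphXn /= map_quadpoly ?rmorph0. Qed.

Lemma conj_act_trpoly x p : conj_act x (trpoly p) = trpoly p.
Proof.
apply/regfun_eqP => g; rewrite trpolyE.
have -> : conj_act x (trpoly p) g = trpoly p (g ^ x)%g by [].
by rewrite trpolyE; congr (p.[_]); have /regfun_eqP := conj_act_tr x; apply.
Qed.

Definition mx2 (u v r s : K) : 'M[K]_2 := \matrix_(i, j)
  (if i == 0 then if j == 0 then u else v else if j == 0 then r else s).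

Fact det_mx2 u v r s : u * s - v * r = 1 -> \det (mx2 u v r s) == 1.
Proof. by rewrite det2E !mxE => <-. Qed.

Fact unip_subproof : \det (mx2 1 0 1 1) == 1.
Proof. by apply: det_mx2; ring. Qed.
Definition unip := MkSL2 unip_subproof.

Fact weyl_subproof : \det (mx2 0 1 (-1) 0) == 1.
Proof. by apply: det_mx2; ring. Qed.
Definition weyl := MkSL2 weyl_subproof.

Lemma unip_lower : lower_unipotent unip.
Proof. by split; rewrite mxE. Qed.

(** For x = [unip] one has det (x^-1 g x v, v) = det (g x v, x v), and x maps (1, s) to (1, s +
    1). *)
Lemma conj_unip_ell :
  quadpoly (conj_act unip b) (conj_act unip (a - d)) (conj_act unip (- c)) = ell \Po ('X + 1).
Proof.
have inv := SL2_invE unip; rewrite !mxE /= in inv; case: inv => i00 i01 i10 i11.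
have iE : invmx unip = (unip^-1)%g by [].
have eb : conj_act unip b = b.
  apply/regfun_eqP => g; rewrite conj_act_entry !(regfunD, regfunZ) iE i00 i01 !mxE /=; ring.
have ead : conj_act unip (a - d) = a - d + b + b.
  apply/regfun_eqP => g; rewrite conj_actD conj_actN !conj_act_entry.
  by rewrite !(regfunD, regfunN, regfunZ) iE i00 i01 i10 i11 !mxE /=; ring.
have ec : conj_act unip (- c) = a - d + b - c.
  apply/regfun_eqP => g; rewrite conj_actN conj_act_entry.
  by rewrite !(regfunD, regfunN, regfunZ) iE i10 i11 !mxE /=; ring.
rewrite eb ead ec /ell /quadpoly !(comp_polyD, comp_polyM, comp_polyC, comp_polyX).
by rewrite !(polyCN, polyCD); ring.
Qed.

Lemma coef_X1_exp (B : comNzRingType) n k : (('X + 1 : {poly B}) ^+ n)`_k = 'C(n, k)%:R.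
Proof.
elim: n k => [|n ih] k; first by rewrite expr0 coef1 bin0n; case: k.
rewrite exprSr mulrDr mulr1 coefD coefMX !ih; case: k => [|k] /=.
  by rewrite add0r !bin0.
by rewrite binS natrD addrC.
Qed.

Lemma coef_comp_X1 (B : comNzRingType) (p : {poly B}) m k : (size p <= m)%N ->
  (p \Po ('X + 1))`_k = \sum_(j < m) p`_j *+ 'C(j, k).
Proof.
move=> pm; rewrite coef_comp_poly (big_ord_widen _ (fun j => p`_j * (('X + 1) ^+ j)`_k) pm).
rewrite big_mkcond; apply: eq_bigr => j _; rewrite coef_X1_exp mulr_natr.
by case: ltnP => // /leq_sizeP -> //; rewrite mul0rn.
Qed.

Lemma conj_unip_harm n k :
  conj_act unip (harm n k) = \sum_(j < (2 * n).+1) harm n j *+ 'C(j, k).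
Proof.
rewrite conj_act_harm conj_unip_ell -rmorphXn /=; apply: coef_comp_X1.
by apply/leq_sizeP => j; apply: harm_big.
Qed.

Lemma conj_unip_expansion N q : conj_act unip (expansion N q) =
  expansion N (fun n k => \sum_(j < (2 * n).+1) q n j *+ 'C(k, j)).
Proof.
rewrite /expansion rmorph_sum; apply: eq_bigr => n _; rewrite rmorph_sum /=.
under eq_bigr => k _ do rewrite rmorphM /= conj_unip_harm conj_act_trpoly mulr_suml.
rewrite exchange_big /=; apply: eq_bigr => k _.
rewrite /trpoly rmorph_sum mulr_sumr; apply: eq_bigr => j _.
by rewrite rmorphMn /= mulrnAl mulrnAr.
Qed.

Lemma coef_quadpolyM (B : comNzRingType) (u v w : B) (p : {poly B}) k :
  (quadpoly u v w * p)`_k.+2 = u * p`_k + v * p`_k.+1 + w * p`_k.+2.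
Proof.
by rewrite /quadpoly !mulrDl !coefD -!mulrA !coefCM !coefXM.
Qed.

(** In degree 2 n only the leading coefficient b of [ell] contributes. *)
Lemma harm_top n : harm n (2 * n) = b ^+ n.
Proof.
elim: n => [|n ih]; first by rewrite /harm expr0 coef1.
rewrite mulnS add2n /harm exprS coef_quadpolyM -!/(harm n _) ih.
by rewrite !harm_big // !mulr0 !addr0 exprS.
Qed.

Lemma harm_bot n : harm n 0 = (- c) ^+ n.
Proof.
rewrite /harm -horner_coef0 horner_exp horner_coef0; congr (_ ^+ n).
by rewrite !coefD !coefCM coefXn coefX coefC /= !mulr0 !add0r.
Qed.

Lemma conj_weyl_b : conj_act weyl b = - c.
Proof.
have inv := SL2_invE weyl; rewrite !mxE /= in inv; case: inv => i00 i01 i10 i11.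
have iE : invmx weyl = (weyl^-1)%g by [].
rewrite !conj_act_entry iE i00 i01 !mxE /=.
by rewrite !(mulr0, mul0r, mulr1, scale0r, scaleN1r) !add0r addr0.
Qed.

(** The trace and a nonzero upper right entry can be prescribed independently in SL2, so b is
    transcendental over C[t]. *)
Lemma b_trpoly_eq0 N (p : nat -> {poly K}) :
  \sum_(n < N) b ^+ n * trpoly (p n) = 0 -> forall n, (n < N)%N -> p n = 0.
Proof.
move=> h n nN; apply: poly_vanish => y.
(* For a fixed trace [y] this is a polynomial in the value z of b. The factor ['X] settles z = 0; it
   also shifts the coefficient sought to index [n.+1]. *)
pose P := 'X * \poly_(i < N) (p i).[y].
suff P0 : P = 0.
  have := congr1 (fun r : {poly K} => r`_n.+1) P0.
  by rewrite coef0 coefXM /= coef_poly nN.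
apply: poly_vanish => z; rewrite hornerM hornerX.
have [->|z0] := eqVneq z 0; first by rewrite mul0r.
(* A point of SL2 with trace [y] and upper right entry [z]. *)
have hg : \det (mx2 y z (- z^-1) 0) == 1.
  by apply: det_mx2; rewrite mulr0 mulrN opprK mulfV // add0r.
have {}h : \sum_(n < N) (b ^+ n * trpoly (p n)) (MkSL2 hg) = 0 by rewrite -regfun_sum h.
rewrite horner_poly (_ : \sum_(i < N) _ = 0) ?mulr0 // -[RHS]h.
apply: eq_bigr => i _; rewrite regfunM regfunX trpolyE mxtrace2E /= !mxE /= addr0.
by rewrite mulrC.
Qed.

Lemma sum_binomial_diff (q : nat -> {poly K}) m k : (k < m)%N ->
  \sum_(j < m) q j *+ 'C(k, j) - q k = \sum_(j < k) q j *+ 'C(k, j).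
Proof.
move=> km; rewrite (big_ord_widen _ (fun j => q j *+ 'C(k, j)) (ltnW km)).
rewrite (bigD1 (Ordinal km)) //= binn mulr1n addrAC subrr add0r.
rewrite big_mkcond [RHS]big_mkcond; apply: eq_bigr => j _.
have -> : (j != Ordinal km) = (j != k :> nat) by [].
by case: ltngtP => // kj; rewrite bin_small.
Qed.

(* Subtracting the conjugate under unip moves the weights up by at least one
   step, so that the extremal terms survive as powers of b. *)
Lemma expansion_eq0 N q : expansion N q = 0 ->
  forall n k, (n < N)%N -> (k < (2 * n).+1)%N -> q n k = 0.
Proof.
(* Induction on the width m of the band 2 n - m <= k <= 2 n that supports [q]; width 2 N covers
   everything. *)
suff key m : forall q, (forall n k, (n < N)%N -> (k + m < 2 * n)%N -> q n k = 0) ->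
    expansion N q = 0 -> forall n k, (n < N)%N -> (k < (2 * n).+1)%N -> q n k = 0.
  apply: (key (2 * N)%N) => n k nN; rewrite ltnNge; case/negP.
  by apply: leq_trans (leq_addl _ _); rewrite leq_mul2l ltnW.
elim: m => {q} [|m ih] q hq q0.
  have top n : (n < N)%N -> q n (2 * n)%N = 0.
    apply: (@b_trpoly_eq0 N (fun n => q n (2 * n)%N)); rewrite -[RHS]q0.
    apply: eq_bigr => {}n _; rewrite big_ord_recr /= big1 ?add0r ?harm_top // => k _.
    by rewrite hq ?addn0 // trpoly0 mulr0.
  move=> n k nN; rewrite ltnS leq_eqVlt => /orP[/eqP->|kn]; first exact: top.
  by rewrite hq ?addn0.
(* The coefficients of the conjugate minus the original: [q' n k] involves only [q n j] with j < k,
   so its band is narrower by one. *)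
pose q' n k := \sum_(j < (2 * n).+1) q n j *+ 'C(k, j) - q n k.
have q'0 : expansion N q' = 0.
  by rewrite expansionB -conj_unip_expansion q0 rmorph0 subrr.
have q'E n k : (k < (2 * n).+1)%N -> q' n k = \sum_(j < k) q n j *+ 'C(k, j).
  exact: sum_binomial_diff.
have {q'0} q'0 : forall n k, (n < N)%N -> (k < (2 * n).+1)%N -> q' n k = 0.
  apply: ih q'0 => n k nN kn; rewrite q'E; last first.
    by rewrite ltnS ltnW // (leq_ltn_trans _ kn) ?leq_addr.
  rewrite big1 // => j _; rewrite hq ?mul0rn // addnS -addSn.
  by rewrite (leq_ltn_trans _ kn) // leq_add2r.
(* At the lower edge of the band, [q' n k.+1] reduces to [k.+1] times [q n k]; its vanishing narrows
   the band of [q] itself. *)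
apply: ih q0 => n k nN kn.
have kn' : (k.+1 < (2 * n).+1)%N by rewrite ltnS (leq_ltn_trans _ kn) ?leq_addr.
have := q'0 n _ nN kn'; rewrite q'E // big_ord_recr /= big1 ?add0r => [|j _]; last first.
  rewrite hq ?mul0rn // addnS -addSn.
  by rewrite (leq_ltn_trans _ kn) // leq_add2r.
rewrite binSn => /eqP; rewrite -mulr_natr mulf_eq0 -[_%:R]polyC_natr polyC_eq0 pnatr_eq0.
by rewrite orbF => /eqP.
Qed.

Lemma expansion_inj N q q' : expansion N q = expansion N q' ->
  forall n k, (n < N)%N -> (k < (2 * n).+1)%N -> q n k = q' n k.
Proof.
move=> e n k nN kn; apply/eqP; rewrite -subr_eq0; apply/eqP.
by apply: (@expansion_eq0 N (fun n k => q n k - q' n k)); rewrite ?expansionB ?e ?subrr.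
Qed.

(** By uniqueness the coefficients agree. If those below k vanish, comparison at index k + 1, which
    is at most 2 n, gives (k + 1) [q n k] = 0. *)
Lemma unip_invariant_coef N q : conj_act unip (expansion N q) = expansion N q ->
  forall n k, (n < N)%N -> (k < 2 * n)%N -> q n k = 0.
Proof.
rewrite conj_unip_expansion => /expansion_inj e n k nN.
elim/ltn_ind: k => k ih kn; have := e n k.+1 nN kn.
move=> /eqP; rewrite -subr_eq0 sum_binomial_diff // big_ord_recr /= big1 ?add0r => [|j _].
  by rewrite binSn -mulr_natr mulf_eq0 -[_%:R]polyC_natr polyC_eq0 pnatr_eq0 orbF => /eqP.
by rewrite ih ?mul0rn // (ltn_trans _ kn).
Qed.

Lemma unip_invariantE N q : conj_act unip (expansion N q) = expansion N q ->
  expansion N q = \sum_(n < N) b ^+ n * trpoly (q n (2 * n)%N).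
Proof.
move=> /unip_invariant_coef h; apply: eq_bigr => n _.
by rewrite big_ord_recr /= big1 ?add0r ?harm_top // => k _; rewrite h // trpoly0 mulr0.
Qed.

(** Invariance under [unip] leaves a sum of b^n p_n(t), and [weyl] rewrites it as a sum of (-c)^n
    p_n(t). One expansion lives at k = 2 n, the other at k = 0, so by uniqueness only n = 0
    survives. *)
Lemma conj_invariantE f : invariants conj_act setT f -> exists p, f = trpoly p.
Proof.
have [N [q /(_ N (leqnn N)) ->]] := spanned_all f => inv.
have hb := unip_invariant_coef (inv unip I).
have e := unip_invariantE (inv unip I).
case: N e hb inv => [|N] e hb inv; first by exists 0; rewrite e big_ord0 trpoly0.
exists (q 0%N 0%N); rewrite e big_ord_recl /= expr0 mul1r big1 ?addr0 // => i _.
(* The coefficients after conjugation by [weyl], since [harm n 0] is the n-th power of -c. *)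
pose q' n k := if k == 0%N then q n (2 * n)%N else 0.
have : expansion N.+1 q = expansion N.+1 q'.
  rewrite -(inv weyl I) {1}e rmorph_sum; apply: eq_bigr => n _.
  rewrite rmorphM rmorphXn /= conj_weyl_b conj_act_trpoly big_ord_recl /= harm_bot.
  by rewrite big1 ?addr0 // => k _; rewrite trpoly0 mulr0.
move=> /expansion_inj/(_ (lift ord0 i) (2 * (lift ord0 i))%N) ->; rewrite ?ltn_ord //.
by rewrite /q' trpoly0 mulr0.
Qed.

End Independence.

(** * The kernel of [opD], its unipotent invariants and harmonicity *)

Section Kernel.
Variable K : numFieldType.
Notation regfun := (regfun K).
Notation b := (entry K 0 1).
Notation opD := (@opD K).
Notation conj_act := (@conj_act K).
Notation harm := (@harm K).
Notation trpoly := (@trpoly K).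
Notation expansion := (@expansion K).
Notation ker := (ker_op opD).
Notation lower_unipotent := (@lower_unipotent K).
Implicit Types (q : nat -> nat -> {poly K}).

Lemma opDP k u v : opD (k *: u + v) = k *: opD u + opD v.
Proof. exact: opD_linear. Qed.

Lemma opD0 : opD 0 = 0.
Proof. by have := opDP (-1) 0 0; rewrite scaler0 addr0 scaleN1r addNr. Qed.

Lemma opDD u v : opD (u + v) = opD u + opD v.
Proof. by rewrite -{1}[u]scale1r opDP scale1r. Qed.

Lemma opD_expansion N q :
  opD (expansion N q) = expansion N (fun n k => radial n (q n k)).
Proof.
have sum I (r : seq I) F : opD (\sum_(i <- r) F i) = \sum_(i <- r) opD (F i).
  exact: (big_morph _ opDD opD0).
rewrite /expansion sum; apply: eq_bigr => n _; rewrite sum.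
by apply: eq_bigr => k _; rewrite opD_harm_trpoly.
Qed.

(** Applied with m + 1 = deg p, this gives the top coefficient of [radial n p]: a nonzero multiple
    of the leading coefficient of p, in degree one higher. *)
Lemma radial_coef n (p : {poly K}) m : p`_m.+3 = 0 ->
  (radial n p)`_m.+2 = - ((4 * m.+1 * m + 8 * n.+1 * m.+1)%:R * p`_m.+1).
Proof.
move=> pm; have -> : radial n p = - (4 * (p^`()^`() * 'X^3)) + 16 * (p^`()^`() * 'X)
    - (8 * n.+1)%:R * (p^`() * 'X^2) - 16 * p^`().
  by rewrite /radial natrM; ring.
rewrite !mulr_natl.
rewrite !(coefMn, coefN, coefMXn, coefMX, coef_deriv, coefD) /= pm !mul0rn oppr0 !addr0.
rewrite subn2 /= -opprD; congr (- _); case: m pm => [|m] pm /=; rewrite ?subn3 /=.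
  by rewrite mul0rn add0r muln0 add0n !muln1 mulr1n.
by rewrite !subSS subn0 -!mulrnA -mulrnDr; congr (_ *+ _); ring.
Qed.

Lemma radial_eq0 n (p : {poly K}) : radial n p = 0 -> p = (p`_0)%:P.
Proof.
move=> h; apply: size1_polyC; rewrite leqNgt; apply/negP => s1.
have : p`_(size p).-1 == 0.
  case e : (size p) s1 => [|[|m]] //= _.
  have pm : p`_m.+3 = 0 by apply: nth_default; rewrite e.
  have := radial_coef n pm; rewrite h coef0 => /eqP.
  by rewrite eq_sym oppr_eq0 mulf_eq0 pnatr_eq0 addn_eq0 !muln_eq0 /= andbF.
by rewrite -lead_coefE lead_coef_eq0 => /eqP p0; rewrite p0 size_poly0 in s1.
Qed.

Lemma ker_expansion N q : ker (expansion N q) ->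
  forall n k, (n < N)%N -> (k < (2 * n).+1)%N -> q n k = ((q n k)`_0)%:P.
Proof.
rewrite /ker_op /= opD_expansion => h n k nN kn.
by apply: (@radial_eq0 n); apply: (expansion_eq0 h).
Qed.

Lemma ker_harm n k : ker (harm n k).
Proof.
rewrite /ker_op /= -[harm n k]mulr1 -trpoly1 opD_harm_trpoly /radial -polyC1 derivC.
by rewrite deriv0 !mulr0 subrr trpoly0 mulr0.
Qed.

Lemma subspace_ker : subspace ker.
Proof.
split=> [|k u v]; first exact: opD0.
by rewrite /ker_op /= opDP => -> ->; rewrite scaler0 addr0.
Qed.

Lemma subspace_invariants S : subspace (invariants conj_act S).
Proof.
split=> [x _|k u v hu hv x Sx]; first exact: conj_act0.
by rewrite conj_actD conj_actZ hu ?hv.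
Qed.

Lemma stable_ker : stable conj_act ker.
Proof. by move=> x f h; rewrite /ker_op /= opD_conj_act h conj_act0. Qed.

Lemma trpoly_invariant p : invariants conj_act setT (trpoly p).
Proof. by move=> x _; apply: conj_act_trpoly. Qed.

Lemma lower_unipotent_b x : lower_unipotent x -> conj_act x b = b.
Proof.
move=> [_ x11 x01]; have [i00 i01 _ _] := SL2_invE x.
apply/regfun_eqP => g; rewrite conj_act_entry !(regfunD, regfunZ).
by rewrite (_ : invmx x = (x^-1)%g) // i00 i01 x11 x01; ring.
Qed.

(** Invariance under [unip] reduces f to a sum of b^n p_n(t), and the kernel condition makes each
    p_n constant. Conversely b^n is [harm n (2 * n)], and b is fixed by the lower unipotent
    group. *)
Lemma ker_lower_unipotent : ker `&` invariants conj_act lower_unipotent =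
  lin_hull (range (fun n : nat => b ^+ n)).
Proof.
apply/seteqP; split=> f.
  move=> [kf /(_ _ (unip_lower K))].
  have [N [q /(_ N (leqnn N)) fE]] := spanned_all f; move: kf; rewrite fE => kf.
  move=> /unip_invariantE ->.
  exists [seq ((q n (2 * n)%N)`_0, b ^+ n) | n <- index_iota 0 N].
    by move=> _ /mapP[n _ ->]; exists n.
  rewrite big_map big_mkord; apply: eq_bigr => n _ /=.
  by rewrite {1}(ker_expansion kf (ltn_ord n) (ltnSn _)) trpolyC -scalerAr mulr1.
apply: lin_hull_min => [|_ [n _ <-]].
  have [k0 kP] := subspace_ker; have [i0 iP] := subspace_invariants lower_unipotent.
  by split=> // k u v [ku iu] [kv iv]; split; [apply: kP|apply: iP].
split; first by rewrite -harm_top; apply: ker_harm.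
by move=> x hx; rewrite conj_actX lower_unipotent_b.
Qed.

(** A normal form for tensors: the same family [q] describes the product in C[G] and the tensor
    itself, as a sum of [harm n k] (x) [trpoly (q n k)]. Injectivity of multiplication thus becomes
    uniqueness of [q]. *)
Lemma tensor_expansion s : tensors ker (invariants conj_act setT) s ->
  exists N q, forall N', (N <= N')%N -> mul_tensor s = expansion N' q /\
    forall (W : lmodType K) (phi : regfun -> regfun -> W),
      bilinear_on ker (invariants conj_act setT) phi ->
    \sum_(x <- s) phi x.1 x.2 =
      \sum_(n < N') \sum_(k < (2 * n).+1) phi (harm n k) (trpoly (q n k)).
Proof.
have sK := subspace_ker; have sI := subspace_invariants setT.
elim: s => [|[h y] s ih] hs.
  exists 0%N, (fun _ _ => 0) => N _; split.
    rewrite /mul_tensor big_nil /expansion big1 // => n _.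
    by rewrite big1 // => k _; rewrite trpoly0 mulr0.
  move=> W phi bphi; rewrite big_nil big1 // => n _; rewrite big1 // => k _.
  by rewrite trpoly0 (bilinear0r sI bphi) //; apply: ker_harm.
have [kh iy] := hs _ (mem_head _ _); rewrite /= in kh iy.
have /ih[N2 [q2 e2]] : tensors ker (invariants conj_act setT) s.
  by move=> x xs; apply: hs; rewrite inE xs orbT.
have [p yE] := conj_invariantE iy.
have [N1 [q1 e1]] := spanned_all h.
(* As [h] lies in the kernel, its coefficients [q1 n k] are constants, which the tensor product lets
   pass to the factor y = p(t). *)
exists (maxn N1 N2), (fun n k => (q1 n k)`_0 *: p + q2 n k) => N.
rewrite geq_max => /andP[N1N N2N]; have [m2 {}e2] := e2 _ N2N; have {}e1 := e1 _ N1N.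
have hc : forall n k, (n < N)%N -> (k < (2 * n).+1)%N -> q1 n k = ((q1 n k)`_0)%:P.
  by apply: ker_expansion; rewrite -e1.
split.
  rewrite /mul_tensor big_cons /= -/(mul_tensor s) m2 expansionD; congr (_ + _).
  rewrite e1 yE mulrC -expansionM; apply: eq_expansion => n k nN kn.
  by rewrite {1}(hc n k) // mulrC mul_polyC.
have {}e1 : h = \sum_(n < N) \sum_(k < (2 * n).+1) (q1 n k)`_0 *: harm n k.
  rewrite e1; apply: eq_bigr => n _; apply: eq_bigr => k _.
  by rewrite {1}(hc n k) // trpolyC -scalerAr mulr1.
have kh' n k : ker ((q1 n k)`_0 *: harm n k) by apply: (subspaceZ _ sK); apply: ker_harm.
move=> W phi bphi; rewrite big_cons /= e2 // e1 (bilinear_suml sK bphi) //; last first.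
  by move=> n; apply: subspace_sum => // k; apply: kh'.
rewrite -big_split /=; apply: eq_bigr => n _.
rewrite (bilinear_suml sK bphi) // -big_split /=; apply: eq_bigr => k _.
have ip := trpoly_invariant p; have kn := @ker_harm n k.
rewrite (bilinearZl sK bphi) // yE -(bilinearZr sI bphi) // trpolyD trpolyZ.
have := bphi.2 1 _ _ _ kn (subspaceZ (q1 n k)`_0 sI ip) (trpoly_invariant (q2 n k)).
by rewrite !scale1r => ->.
Qed.

Lemma cofree_for_ker : cofree_for conj_act ker.
Proof.
split; [exact: subspace_ker|exact: stable_ker|split].
  move=> s s' /tensor_expansion[N [q e]] /tensor_expansion[N' [q' e']] m W phi bphi.
  (* Both tensors are put in normal form with the common bound [maxn N N'], where [expansion_inj]
     identifies their coefficients. *)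
  have [m1 ->] := e _ (leq_maxl N N') => //; have [m2 ->] := e' _ (leq_maxr N N') => //.
  rewrite m1 m2 in m; apply: eq_bigr => n _; apply: eq_bigr => k _.
  by rewrite (expansion_inj m).
move=> f; have [N [q /(_ N (leqnn N)) ->]] := spanned_all f.
(* Surjectivity: the expansion of [f] is itself the image of a tensor. *)
exists [seq (harm n k, trpoly (q n k)) | n <- index_iota 0 N, k <- index_iota 0 (2 * n).+1].
  move=> _ /allpairsPdep[n [k [_ _ ->]]] /=.
  by split; [apply: ker_harm|apply: trpoly_invariant].
rewrite /mul_tensor big_allpairs_dep /= big_mkord; apply: eq_bigr => n _.
by rewrite big_mkord.
Qed.

Lemma harmonic_conj_act : harmonic conj_act.
Proof.
split; first by exists ker; apply: cofree_for_ker.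
exists 1%N, (fun _ => opD); split.
  by move=> _; split; [apply: opD_diff_op|apply: opD_conj_act].
rewrite bigcap_const; first exact: cofree_for_ker.
by exists ord0.
Qed.

End Kernel.

Theorem theorem5p3 (R : realType) :
  [/\ diff_op (@opD R[i]),
      invariant_op (@conj_act R[i]) (@opD R[i]),
      ker_op (@opD R[i]) `&`
        invariants (@conj_act R[i]) (@lower_unipotent R[i]) =
        lin_hull (range (fun n : nat => entry R[i] 0 1 ^+ n))
    & harmonic (@conj_act R[i])].
Proof.
split; [exact: opD_diff_op|exact: opD_conj_act|exact: ker_lower_unipotent|].
exact: harmonic_conj_act.
Qed.
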